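(* Let $k>0$ be an integer, let $\mathsf{ops}\subseteq\{+,-,\times,\div\}$, and let $\mathsf{var}\in\{\text{Standard},\text{Enforced Leaves},\text{Enforced Operations}\}$. There exists a polynomial-time algorithm $\mathcal{A}$ mapping each instance $I$ of the $\mathsf{var}$ variant of Arithmetic Expression Construction over $\mathbb{Q}(x_1,\ldots,x_k)$ with operations $\mathsf{ops}$ to a positive integer $\mathcal{A}(I)$ such that, for every $B\in\mathbb{N}$ with $B\ge\mathcal{A}(I)$, substituting $x_k=B$ in (every value of) the instance $I$ gives a polynomial-time reduction from the $\mathsf{var}$ variant of Arithmetic Expression Construction over $\mathbb{Q}(x_1,\ldots,x_k)$ with operations $\mathsf{ops}$ to the $\mathsf{var}$ variant over $\mathbb{Q}(x_1,\ldots,x_{k-1})$ with operations $\mathsf{ops}$ (i.e. $I$ is solvable if and only if the substituted instance is solvable). Here $\mathbb{Q}(x_1,\ldots,x_0)=\mathbb{Q}$.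
   Context: An expression tree is a rooted binary tree whose leaves carry values and whose internal nodes carry operations from $\{+,-,\times,\div\}$; it evaluates in the natural way (the value of an internal node is its operation applied to the values of its left and right children). Arithmetic Expression Construction (AEC) over a set $\mathbb{L}$ with operation set $\mathsf{ops}$ has three variants. Standard: given a multiset $A=\{a_1,\ldots,a_n\}\subseteq\mathbb{L}$ and a target $t\in\mathbb{L}$, decide whether there is an expression tree with all internal operations in $\mathsf{ops}$ whose leaves are exactly the elements of $A$ (each used once) and which evaluates to $t$. Enforced Leaves: additionally a leaf order $a_1,\ldots,a_n$ is given, and the leaves of the tree, read left to right, must be exactly this list. Enforced Operations: additionally an expression tree with internal nodes labelled by operations from $\mathsf{ops}$ and empty leaves is given, and one asks whether the elements of $A$ can be assigned bijectively to the leaves so that the tree evaluates to $t$. An instance is written $(A,t,D)$ where $D$ is the extra data (leaf order or tree). *)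

(* Defs.v *)
From HB Require Import structures.
From mathcomp Require Import all_boot all_order all_algebra.
From mathcomp Require Import mpoly.

Set Implicit Arguments.
Unset Strict Implicit.
Unset Printing Implicit Defensive.

Import GRing.Theory.
Local Open Scope ring_scope.

(** * Multi-tape Turing machines and polynomial time *)

Inductive sym := Bit0 | Bit1 | Open | Close.

Definition bit (b : bool) : sym := if b then Bit1 else Bit0.

Definition word := seq sym.

(* A tape cell; [None] is the blank. *)
Definition cell := option sym.

(* A two-way infinite tape: the cells strictly to the left of the head, nearest
   first, and the cells from the head rightwards; all other cells are blank. *)
Definition tape : Type := seq cell * seq cell.

Inductive move := MoveL | Stay | MoveR.

Definition read (t : tape) : cell := head None t.2.

Definition write (a : cell) (t : tape) : tape := (t.1, a :: behead t.2).

Definition shift (m : move) (t : tape) : tape :=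
  match m with
  | MoveL => (behead t.1, head None t.1 :: t.2)
  | Stay => t
  | MoveR => (head None t.2 :: t.1, behead t.2)
  end.

(* The machine has [tm_extra.+1] tapes and stops when [tm_delta] is [None]. *)
Record turing_machine := TuringMachine {
  tm_extra : nat;
  tm_state : finType;
  tm_start : tm_state;
  tm_delta : tm_state -> {ffun 'I_tm_extra.+1 -> cell} ->
             option (tm_state * {ffun 'I_tm_extra.+1 -> cell * move})
}.

Section Run.
Variable M : turing_machine.

Definition tapes := {ffun 'I_(tm_extra M).+1 -> tape}.

Definition step (q : tm_state M) (ts : tapes) : option (tm_state M * tapes) :=
  if tm_delta q [ffun i => read (ts i)] is Some (q', act)
  then Some (q', [ffun i => shift (act i).2 (write (act i).1 (ts i))])
  else None.

(* The tapes at the moment the machine stops, provided this happens after at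
   most [n] steps. *)
Fixpoint run (n : nat) (q : tm_state M) (ts : tapes) : option tapes :=
  match step q ts, n with
  | None, _ => Some ts
  | Some _, 0 => None
  | Some (q', ts'), n'.+1 => run n' q' ts'
  end.

Definition input_tapes (w : word) : tapes :=
  [ffun i => if i == ord0 then ([::], map Some w) else ([::], [::])].

Fixpoint until_blank (s : seq cell) : word :=
  if s is Some a :: s' then a :: until_blank s' else [::].

(* The output is read on the last tape, from the head to the first blank. *)
Definition output (ts : tapes) : word := until_blank (ts ord_max).2.

Definition outputs_within (n : nat) (w w' : word) : Prop :=
  omap output (run n (tm_start M) (input_tapes w)) = Some w'.

End Run.

(* On every input satisfying the promise [P], [f] is computed in a number of
   steps polynomial in the length of the encoded input. *)
Definition poly_time (X Y : Type) (P : X -> Prop)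
    (encX : X -> word) (encY : Y -> word) (f : X -> Y) : Prop :=
  exists (M : turing_machine) (c d : nat), forall x : X, P x ->
    outputs_within M (c * size (encX x) ^ d + c)%N (encX x) (encY (f x)).

(** * Encodings *)

Definition bracket (w : word) : word := Open :: rcons w Close.

(* Binary digits of [n], least significant first, without leading zeros:
   [up_log 2 n.+1] is the bit length of [n]. *)
Definition bits (n : nat) : word :=
  mkseq (fun i => bit (odd (n %/ 2 ^ i))) (up_log 2 n.+1).

Definition enc_nat (n : nat) : word := bracket (bits n).

Definition enc_int (z : int) : word :=
  bracket (bit (z < 0) :: bits `|z|%N).

Definition enc_unary (n : nat) : word := bracket (nseq n Bit1).

Definition enc_seq (X : Type) (enc : X -> word) (s : seq X) : word :=
  bracket (flatten (map enc s)).

Definition enc_pair (X Y : Type) (encX : X -> word) (encY : Y -> word)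
    (u : X * Y) : word :=
  bracket (encX u.1 ++ encY u.2).

(** * Expression trees *)

Inductive op := Add | Sub | Mul | Div.

Inductive tree (L : Type) :=
  | Leaf of L
  | Node of op & tree L & tree L.

Fixpoint leaves (L : Type) (T : tree L) : seq L :=
  match T with
  | Leaf a => [:: a]
  | Node _ T1 T2 => leaves T1 ++ leaves T2
  end.

Fixpoint ops_in (L : Type) (ops : pred op) (T : tree L) : bool :=
  match T with
  | Leaf _ => true
  | Node o T1 T2 => [&& ops o, ops_in ops T1 & ops_in ops T2]
  end.

(* An expression tree with empty leaves. *)
Definition skeleton := tree unit.

Fixpoint skeleton_of (L : Type) (T : tree L) : skeleton :=
  match T with
  | Leaf _ => Leaf tt
  | Node o T1 T2 => Node o (skeleton_of T1) (skeleton_of T2)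
  end.

Definition apply_op (F : fieldType) (o : op) (a b : F) : option F :=
  match o with
  | Add => Some (a + b)
  | Sub => Some (a - b)
  | Mul => Some (a * b)
  | Div => if b == 0 then None else Some (a / b)
  end.

(* A tree containing a division by zero has no value. *)
Fixpoint eval (F : fieldType) (T : tree F) : option F :=
  match T with
  | Leaf a => Some a
  | Node o T1 T2 =>
      obind (fun a => obind (fun b => apply_op o a b) (eval T2)) (eval T1)
  end.

(** * Arithmetic Expression Construction *)

Inductive variant := Standard | EnforcedLeaves | EnforcedOperations.

(* The multiset of values is listed as a sequence. With enforced leaves, the
   order of that sequence is the prescribed leaf order, so that no further data
   is needed; in the other two variants the order is irrelevant. *)
Definition extra (v : variant) : Type :=
  if v is EnforcedOperations then skeleton else unit.

Definition respects (F : fieldType) (v : variant) :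
    seq F -> extra v -> tree F -> Prop :=
  match v return seq F -> extra v -> tree F -> Prop with
  | Standard => fun A _ T => perm_eq (leaves T) A
  | EnforcedLeaves => fun A _ T => leaves T = A
  | EnforcedOperations =>
      fun A D T => skeleton_of T = D /\ perm_eq (leaves T) A
  end.

Definition AEC (F : fieldType) (ops : pred op) (v : variant)
    (A : seq F) (t : F) (D : extra v) : Prop :=
  exists T : tree F, [/\ ops_in ops T, respects A D T & eval T = Some t].

(** * Instances over Q(x_1, ..., x_k) *)

(* For k = 0 this is a copy of [rat]. *)
Definition ratfun (k : nat) : fieldType := {fraction {mpoly rat[k]}}.

(* A rational function is presented as a quotient of two integer polynomials,
   and a polynomial as a list of monomials with coefficients; repeated monomials
   and zero coefficients are allowed. *)
Definition term (k : nat) : Type := 'X_{1..k} * int.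
Definition poly_code (k : nat) := seq (term k).
Definition ratfun_code (k : nat) : Type := poly_code k * poly_code k.

Definition poly_val (k : nat) (p : poly_code k) : {mpoly rat[k]} :=
  \sum_(u <- p) u.2%:~R *: 'X_[u.1].

Definition ratfun_val (k : nat) (f : ratfun_code k) : ratfun k :=
  tofrac (poly_val f.1) / tofrac (poly_val f.2).

Record instance (k : nat) (v : variant) := Instance {
  inst_values : seq (ratfun_code k);
  inst_target : ratfun_code k;
  inst_extra : extra v
}.

Definition ops_allowed (ops : pred op) (v : variant) : extra v -> bool :=
  match v return extra v -> bool with
  | EnforcedOperations => fun D => ops_in ops D
  | _ => fun _ => true
  end.

Definition wf_instance (k : nat) (v : variant) (ops : pred op)
    (I : instance k v) : bool :=
  [&& all (fun f : ratfun_code k => poly_val f.2 != 0) (inst_values I),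
      poly_val (inst_target I).2 != 0
    & ops_allowed ops (inst_extra I)].

Definition solvable (k : nat) (v : variant) (ops : pred op)
    (I : instance k v) : Prop :=
  AEC ops (map (@ratfun_val k) (inst_values I)) (ratfun_val (inst_target I))
      (inst_extra I).

(* Exponents are written in unary (with binary exponents, [B ^ e] would not have
   polynomial length); coefficients are written in binary. *)
Definition enc_monomial (k : nat) (m : 'X_{1..k}) : word :=
  enc_seq enc_unary m.

Definition enc_poly (k : nat) : poly_code k -> word :=
  enc_seq (enc_pair (@enc_monomial k) enc_int).

Definition enc_ratfun (k : nat) : ratfun_code k -> word :=
  enc_pair (@enc_poly k) (@enc_poly k).

Definition enc_op (o : op) : word :=
  match o with
  | Add => [:: Bit0; Bit0]
  | Sub => [:: Bit0; Bit1]
  | Mul => [:: Bit1; Bit0]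
  | Div => [:: Bit1; Bit1]
  end.

Fixpoint enc_skeleton (D : skeleton) : word :=
  match D with
  | Leaf _ => bracket [::]
  | Node o D1 D2 => bracket (enc_op o ++ enc_skeleton D1 ++ enc_skeleton D2)
  end.

Definition enc_extra (v : variant) : extra v -> word :=
  match v return extra v -> word with
  | EnforcedOperations => enc_skeleton
  | _ => fun _ => [::]
  end.

Definition enc_instance (k : nat) (v : variant) (I : instance k v) : word :=
  bracket (enc_seq (@enc_ratfun k) (inst_values I) ++
           enc_ratfun (inst_target I) ++ enc_extra (inst_extra I)).

(** * Substituting the last variable *)

(* The last variable x_(k+1) is indexed by [ord_max]; [lift ord_max] embeds the
   indices of the other variables. *)
Definition subst_term (k : nat) (B : nat) (u : term k.+1) : term k :=
  ([multinom u.1 (lift ord_max i) | i < k],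
   u.2 * (B ^ u.1 ord_max)%N%:Z).

Definition subst_poly (k : nat) (B : nat) (p : poly_code k.+1) : poly_code k :=
  map (subst_term B) p.

Definition subst_ratfun (k : nat) (B : nat) (f : ratfun_code k.+1) :
    ratfun_code k :=
  (subst_poly B f.1, subst_poly B f.2).

Definition subst_instance (k : nat) (v : variant) (B : nat)
    (I : instance k.+1 v) : instance k v :=
  Instance (map (subst_ratfun B) (inst_values I))
           (subst_ratfun B (inst_target I)) (inst_extra I).

Lemma subst_polyE (k B : nat) (p : poly_code k.+1) :
  poly_val (subst_poly B p) =
  poly_val p \mPo [tuple if unlift ord_max i is Some j then 'X_j
                         else (B%:R : rat)%:MP_[k] | i < k.+1].
Proof.
rewrite /poly_val /subst_poly big_map raddf_sum /=.
apply: eq_bigr => u _.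
rewrite comp_mpolyZ comp_mpolyX big_ord_recr /= tnth_mktuple unlift_none /=.
rewrite -rmorphXn /= [in RHS]mulrC mul_mpolyC scalerA; congr (_ *: _).
  by rewrite intrM -pmulrn natrX.
rewrite mpolyXE_id; apply: eq_bigr => i _.
have ->: widen_ord (leqnSn k) i = lift ord_max i.
  by apply: val_inj; rewrite /= /bump leqNgt ltn_ord.
by rewrite tnth_mktuple liftK mnmE.
Qed.

(* Main.v *)
Require Import Defs.
From HB Require Import structures.
From mathcomp Require Import all_boot all_order all_algebra.
From mathcomp Require Import mpoly zify.

(* Take A(I) = 2 ^ N, where N is the length of the encoding of I. An expression
   tree over the values of I has a formal numerator and denominator with integer
   coefficients; the norm "sum of the absolute values of the coefficients" is
   submultiplicative and subadditive, so these norms, and that of the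
   cross-multiplied difference with the target, are below 2 ^ N. A nonzero
   polynomial of norm less than B stays nonzero when its last variable is set to
   B: some coefficient with respect to the other variables is a nonzero integer
   polynomial in one variable whose coefficients are less than B in absolute
   value. Hence the same trees divide by zero, and the same trees reach the
   target, before and after the substitution.

   On the machine side, A depends only on the length of the input, and the
   substitution is a single pass over the input that multiplies each coefficient
   by a power of B; the power has polynomial size since exponents are unary. *)

Set Implicit Arguments.
Unset Strict Implicit.
Unset Printing Implicit Defensive.

(** * Programs for machines with six tapes *)

(* Tape [In] holds the unread input, [Base] the number B, [Exp] an exponent in
   unary, [Fac] the power of B times a coefficient computed so far, [Prod] the
   product under construction, and [Out] the output. *)
Record six (T : Type) := Six
  { in6 : T; base6 : T; exp6 : T; fac6 : T; prod6 : T; out6 : T }.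

Inductive tape_name := In | Base | Exp | Fac | Prod | Out.

Definition same_tape (i j : tape_name) : bool :=
  match i, j with
  | In, In | Base, Base | Exp, Exp | Fac, Fac | Prod, Prod | Out, Out => true
  | _, _ => false
  end.

Definition get T (i : tape_name) (m : six T) : T :=
  match i with
  | In => in6 m | Base => base6 m | Exp => exp6 m
  | Fac => fac6 m | Prod => prod6 m | Out => out6 m
  end.

Definition set T (i : tape_name) (x : T) (m : six T) : six T :=
  let: Six a b c d e f := m in
  match i with
  | In => Six x b c d e f | Base => Six a x c d e f | Exp => Six a b x d e f
  | Fac => Six a b c x e f | Prod => Six a b c d x f | Out => Six a b c d e x
  end.

Definition map6 T U (g : T -> U) (m : six T) : six U :=
  let: Six a b c d e f := m in Six (g a) (g b) (g c) (g d) (g e) (g f).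

Definition zip6 T U V (g : T -> U -> V) (m : six T) (m' : six U) : six V :=
  let: Six a b c d e f := m in let: Six a' b' c' d' e' f' := m' in
  Six (g a a') (g b b') (g c c') (g d d') (g e e') (g f f').

Definition memory := six tape.

(* [None] leaves the tape as it is. *)
Definition action := option (cell * Defs.move).

(* No blank is ever stored at the far end of a half-tape, so that tapes with
   the same contents are represented by the same pair of sequences. *)
Definition push (a : cell) (s : seq cell) : seq cell :=
  if a is None then if s is [::] then [::] else a :: s else a :: s.

Definition act (a : action) (t : tape) : tape :=
  match a with
  | None => t
  | Some (c, MoveL) => (behead t.1, push (head None t.1) (push c (behead t.2)))
  | Some (c, Stay) => (t.1, push c (behead t.2))
  | Some (c, MoveR) => (push c t.1, behead t.2)
  end.

Definition idle : six action := Six None None None None None None.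

Record component := Component {
  state : finType;
  start : state;
  delta : state -> six cell -> option state * six action
}.

(** The exiting transition also acts on the tapes and counts as a step, so every run takes at least
    one step. *)
Inductive runs (C : component) : state C -> memory -> nat -> memory -> Prop :=
  | runs_exit s m a :
      delta s (map6 read m) = (None, a) -> runs s m 1 (zip6 act a m)
  | runs_step s s' m a n m' :
      delta s (map6 read m) = (Some s', a) -> runs s' (zip6 act a m) n m' ->
      runs s m n.+1 m'.

Lemma runs_last C s m a m' :
  delta s (map6 read m) = (None, a) -> zip6 act a m = m' -> @runs C s m 1 m'.
Proof. by move=> ds <-; apply: runs_exit. Qed.

(** The number is only an upper bound on the running time, so costs can be rounded up at each
    composition. *)
Definition exec (C : component) (m : memory) (n : nat) (m' : memory) : Prop :=
  exists2 n', (n' <= n)%N & runs (start C) m n' m'.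

Lemma exec_runs C m n m' : runs (start C) m n m' -> exec C m n m'.
Proof. by exists n. Qed.

Lemma exec_le C m n n' m' : exec C m n m' -> (n <= n')%N -> exec C m n' m'.
Proof. by case=> p le_pn Cm le_nn'; exists p => //; apply: leq_trans le_nn'. Qed.

(** * Sequencing, branching and loops *)

Definition once (a : six cell -> six action) : component :=
  @Component unit tt (fun _ r => (None, a r)).

Lemma exec_once a m : exec (once a) m 1 (zip6 act (a (map6 read m)) m).
Proof. by exists 1%N => //; apply: runs_exit. Qed.

Section Seq.
Variables C1 C2 : component.

(** The transition by which [C1] exits leads directly into [C2], so composition costs no extra
    step. *)
Definition then_ : component :=
  @Component (state C1 + state C2)%type (inl (start C1))
    (fun s r => match s with
     | inl s1 => let: (o, a) := delta s1 r in
                 (if o is Some s1' then Some (inl s1') else Some (inr (start C2)), a)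
     | inr s2 => let: (o, a) := delta s2 r in (omap inr o, a)
     end).

Lemma exec_then n1 n2 m m1 m2 :
  exec C1 m n1 m1 -> exec C2 m1 n2 m2 -> exec then_ m (n1 + n2) m2.
Proof.
case=> p1 le_p1 run1 [p2 le_p2 run2]; exists (p1 + p2)%N; first exact: leq_add.
rewrite /=; elim: run1 run2 => {m m1 p1 le_p1} [s m a ds|s s' m a p1 m1 ds _ IH] run2.
  rewrite add1n; apply: (@runs_step then_ _ (inr (start C2)) _ a); first by rewrite /= ds.
  elim: run2 => [{}s {}m b {}ds|{}s {}s' {}m b p {}m1 {}ds _ IH].
    by apply: runs_exit; rewrite /= ds.
  by apply: runs_step IH; rewrite /= ds.
by rewrite addSn; apply: runs_step (IH run2); rewrite /= ds.
Qed.

End Seq.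

Section Branch.
Variables (test : six cell -> bool) (C : component).

Definition when : component :=
  @Component (option (state C)) None
    (fun s r => match s with
     | None => (if test r then Some (Some (start C)) else None, idle)
     | Some s1 => let: (o, a) := delta s1 r in (omap some o, a)
     end).

Lemma idleE m : zip6 act idle m = m. Proof. by case: m. Qed.

Lemma exec_when_true n m m' :
  test (map6 read m) -> exec C m n m' -> exec when m n.+1 m'.
Proof.
move=> tm [p le_pn run_p]; exists p.+1 => //.
apply: (@runs_step when _ (Some (start C)) _ idle); first by rewrite /= tm.
rewrite idleE; elim: run_p => {m m' p le_pn tm} [s m a ds|s s' m a p m1 ds _ IH].
  by apply: runs_exit; rewrite /= ds.
by apply: runs_step IH; rewrite /= ds.
Qed.

Lemma exec_when_false m : ~~ test (map6 read m) -> exec when m 1 m.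
Proof.
move=> /negPf tm; exists 1%N => //.
by rewrite -{2}[m]idleE; apply: runs_exit; rewrite /= tm.
Qed.

(** When the body exits, [o] is [None], and the successor [Some None] is the test state again. *)
Definition while : component :=
  @Component (option (state C)) None
    (fun s r => match s with
     | None => (if test r then Some (Some (start C)) else None, idle)
     | Some s1 => let: (o, a) := delta s1 r in (Some o, a)
     end).

Lemma exec_while_true n1 n2 m m1 m2 :
  test (map6 read m) -> exec C m n1 m1 -> exec while m1 n2 m2 ->
  exec while m (n1 + n2).+1 m2.
Proof.
move=> tm [p1 le_p1 run1] [p2 le_p2 run2]; exists (p1 + p2).+1.
  by rewrite ltnS leq_add.
apply: (@runs_step while _ (Some (start C)) _ idle); first by rewrite /= tm.
rewrite idleE; elim: run1 run2 => {m m1 p1 le_p1 tm} [s m a ds|s s' m a p m1 ds _ IH] run2.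
  by apply: runs_step run2; rewrite /= ds.
by apply: runs_step (IH run2); rewrite /= ds.
Qed.

Lemma exec_while_false m : ~~ test (map6 read m) -> exec while m 1 m.
Proof.
move=> /negPf tm; exists 1%N => //.
by rewrite -{2}[m]idleE; apply: runs_exit; rewrite /= tm.
Qed.

End Branch.

(** * Compilation to Turing machines *)

Definition tape_of (i : 'I_6) : tape_name :=
  nth Out [:: In; Base; Exp; Fac; Prod] i.

Definition idx (i : tape_name) : 'I_6 :=
  match i with
  | In => inord 0 | Base => inord 1 | Exp => inord 2
  | Fac => inord 3 | Prod => inord 4 | Out => inord 5
  end.

Lemma tape_ofK : cancel idx tape_of.
Proof. by case; rewrite /tape_of /= inordK. Qed.

Definition six_of T (f : {ffun 'I_6 -> T}) : six T :=
  Six (f (idx In)) (f (idx Base)) (f (idx Exp))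
      (f (idx Fac)) (f (idx Prod)) (f (idx Out)).

Lemma get_six_of T (f : {ffun 'I_6 -> T}) i : get i (six_of f) = f (idx i).
Proof. by case: i. Qed.

Lemma get_map6 T U (g : T -> U) i m : get i (map6 g m) = g (get i m).
Proof. by case: i; case: m. Qed.

Lemma get_zip6 T U V (g : T -> U -> V) i m m' :
  get i (zip6 g m m') = g (get i m) (get i m').
Proof. by case: i; case: m; case: m'. Qed.

Lemma six_eq T (m m' : six T) : (forall i, get i m = get i m') -> m = m'.
Proof.
case: m => a b c d e f; case: m' => a' b' c' d' e' f' eq_m.
have /= := (eq_m In, eq_m Base, eq_m Exp, (eq_m Fac, eq_m Prod, eq_m Out)).
by case=> [] [[-> ->] ->] [[-> ->] ->].
Qed.

(** The added state [None] halts; the exiting transition of [C] leads to it. A tape without an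
    action has the symbol under its head rewritten. *)
Definition machine (C : component) : turing_machine :=
  @TuringMachine 5 (option (state C)) (Some (start C))
    (fun s r => if s is Some s1 then
        let: (o, a) := delta s1 (six_of r) in
        Some (o, [ffun i => odflt (r i, Stay) (get (tape_of i) a)])
      else None).

(** The tapes of a Turing machine may collect blanks at their far ends, which [push] drops, so the
    two representations agree only cell by cell. *)
Definition same_cells (s s' : seq cell) : Prop :=
  forall i, nth None s i = nth None s' i.

Definition same_contents (t t' : tape) : Prop :=
  same_cells t.1 t'.1 /\ same_cells t.2 t'.2.

Lemma same_head s s' : same_cells s s' -> head None s = head None s'.
Proof. by move/(_ 0%N); rewrite !nth0. Qed.

Lemma same_behead s s' : same_cells s s' -> same_cells (behead s) (behead s').
Proof. by move=> eq_s i; rewrite !nth_behead. Qed.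

Lemma same_push a s s' : same_cells s s' -> same_cells (a :: s) (push a s').
Proof.
move=> eq_s [|i]; first by case: a s' {eq_s} => [a|] [|b s'].
by rewrite /= eq_s; case: a s' {eq_s} => [a|] [|b s'] //=; rewrite nth_nil.
Qed.

Lemma same_act a t t' : same_contents t t' ->
  same_contents (let: (c, mv) := odflt (read t, Stay) a in shift mv (write c t))
                (act a t').
Proof.
case: t t' => l r [l' r'] [/= eql eqr].
case: a => [[c []]|] /=; rewrite /shift /write /=; split=> //=.
- exact: same_behead.
- by rewrite (same_head eql); do 2!apply: same_push; apply: same_behead.
- by apply: same_push; apply: same_behead.
- by apply: same_push.
- exact: same_behead.
by move=> i; rewrite -eqr /read /=; case: r i {eqr} => [|x r] [|i] //=; rewrite nth_nil.
Qed.

Definition implements (ts : {ffun 'I_6 -> tape}) (m : memory) : Prop :=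
  forall i, same_contents (ts (idx i)) (get i m).

(** The surplus [d] allows for time bounds that are not exact. *)
Lemma run_machine C s m n m' d ts :
  runs s m n m' -> implements ts m ->
  exists2 ts' : tapes (machine C),
    run (M := machine C) (n + d) (Some s) ts = Some ts' & implements ts' m'.
Proof.
move=> run_s; elim: run_s ts => {s m n m'} [s m a ds|s s' m a n m' ds _ IH] ts imp_ts.
all: set rs := [ffun i => read (ts i)].
all: have Ers : six_of rs = map6 read m.
all: try by apply: six_eq => i; rewrite get_six_of get_map6 ffunE /read
  (same_head (proj2 (imp_ts i))).
all: set ac : {ffun 'I_6 -> cell * Defs.move} :=
  [ffun i => odflt (rs i, Stay) (get (tape_of i) a)].
all: pose ts1 : tapes (machine C) := [ffun i => shift (ac i).2 (write (ac i).1 (ts i))].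
all: have imp1 : implements ts1 (zip6 act a m).
all: try by move=> i; rewrite ffunE get_zip6 ffunE tape_ofK ffunE;
  have := same_act (get i a) (imp_ts i); case: (odflt _ _).
  exists ts1 => //; rewrite /= /step /= -/rs Ers ds /=; case: d => [|d] //.
have [ts' run_ts' imp'] := IH _ imp1; exists ts' => //.
by rewrite addSn /= {1}/step /= -/rs Ers ds.
Qed.

Lemma same_until_blank s s' : same_cells s s' -> until_blank s = until_blank s'.
Proof.
elim: s s' => [|x s IH] s' eq_s.
  by have := eq_s 0%N; case: s' {eq_s} => [|[a|] s'].
have := same_head eq_s; have := IH _ (same_behead eq_s).
case: s' {eq_s} => [|y s'] /=; first by case: x.
by move=> IHs <-; case: x => [a|] //; rewrite IHs.
Qed.

Lemma until_blank_Some w : until_blank (map Some w) = w.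
Proof. by elim: w => //= a w ->. Qed.

Definition blank : tape := ([::], [::]).
(* The head is at the left end of the word, respectively just after it. *)
Definition home (w : word) : tape := ([::], map Some w).
Definition spent (w : word) : tape := (map Some (rev w), [::]).

Lemma machine_outputs C n w w' (m : memory) :
  exec C (Six (home w) blank blank blank blank blank) n m ->
  out6 m = home w' -> outputs_within (machine C) n w w'.
Proof.
case=> p le_pn run_p out_m.
have [|ts' run_ts' imp'] := run_machine (n - p) (ts := input_tapes (machine C) w) run_p.
  move=> i; rewrite ffunE -val_eqE.
  by case: i; rewrite /= ?inordK.
rewrite /outputs_within; move: run_ts'; rewrite subnKC // => ->.
rewrite /= /output; congr Some.
have ->: ord_max = idx Out by apply: val_inj; rewrite /= inordK.
by rewrite (same_until_blank (proj2 (imp' Out))) /= out_m until_blank_Some.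
Qed.

(** * Binary arithmetic on tapes *)

Lemma bitsE n : bits n = if n is 0 then [::] else bit (odd n) :: bits n./2.
Proof.
case: n => [|n]; first by rewrite /bits up_log1.
rewrite /bits up_log2S // /mkseq /= divn1; congr (_ :: _).
rewrite (iotaDl 1 0) -map_comp; apply: eq_map => i /=.
by rewrite expnS divnMA divn2.
Qed.

Lemma leq_size_bits m n : m <= n -> size (bits m) <= size (bits n).
Proof. by move=> le_mn; rewrite !size_mkseq; apply: leq_up_log. Qed.

Lemma size_bitsM m n : size (bits (m * n)) <= size (bits m) + size (bits n).
Proof.
case: m n => [|m] [|n]; rewrite ?muln0 ?mul0n ?[bits 0]bitsE //.
rewrite !size_mkseq up_log_min // expnD.
apply: leq_trans (leq_mul (up_logP _ _) (up_logP _ _)) => //; nia.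
Qed.

Lemma size_bitsX m n : size (bits (m ^ n)) <= n * size (bits m) + 1.
Proof.
elim: n => [|n IH]; first by rewrite expn0 bitsE [bits 1./2]bitsE.
rewrite expnS mulSn -addnA; apply: leq_trans (size_bitsM _ _) _.
by rewrite leq_add2l.
Qed.

Definition isbit (a : sym) : bool :=
  match a with Bit0 | Bit1 => true | Open | Close => false end.

Lemma all_isbit_bits n : all isbit (bits n).
Proof. by rewrite all_map; apply/allP => i _ /=; case: (odd _). Qed.

(** The source is erased on the way: blanks pushed onto an empty left half vanish, so its head
    remains at the left end. The head of the target ends just after the word. *)
Definition transfer (p : pred sym) (i j : tape_name) : component :=
  @Component unit tt (fun _ r =>
    if get i r is Some a then
      if p a then (Some tt, set i (Some (None, MoveR))
                              (set j (Some (Some a, MoveR)) idle))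
      else (None, idle)
    else (None, idle)).

Lemma get_map_set T U (g : T -> U) i x m : get i (map6 g (set i x m)) = g x.
Proof. by case: i; case: m. Qed.

Lemma zip_act_set i a t m :
  zip6 act (set i a idle) (set i t m) = set i (act a t) m.
Proof. by case: i; case: m. Qed.

Lemma zip_act_set2 i j a b t u m : ~~ same_tape i j ->
  zip6 act (set i a (set j b idle)) (set i t (set j u m)) =
  set i (act a t) (set j (act b u) m).
Proof. by case: i; case: j; case: m. Qed.

Lemma exec_transfer (p : pred sym) i j w s l m :
  ~~ same_tape i j -> all p w -> (if s is Some a :: _ then ~~ p a else true) ->
  exec (transfer p i j)
    (set i ([::], map Some w ++ s) (set j (map Some l, [::]) m)) (size w).+1
    (set i ([::], s) (set j (map Some (rev w ++ l), [::]) m)).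
Proof.
move=> neq_ij; elim: w l => [|a w IH] l /= => [_|/andP[pa pw]] p_s.
  exists 1%N => //.
  rewrite -{2}[set i _ _]idleE; apply: runs_exit; rewrite /= get_map_set.
  by case: s p_s => [|[a|] s] //= /negPf ->.
have [n le_n run_n] := IH (a :: l) pw p_s; exists n.+1 => //=.
apply: (@runs_step (transfer p i j) _ tt); first by rewrite /= get_map_set /read /= pa.
by rewrite zip_act_set2 // rev_cons cat_rcons.
Qed.

(** The state [true] forces a first move to the left, as the head starts on the blank after the
    word; the blank before the word then ends the scan. *)
Definition rewind (i : tape_name) : component :=
  @Component bool true (fun s r =>
    if s || isSome (get i r) then (Some false, set i (Some (get i r, MoveL)) idle)
    else (None, set i (Some (None, MoveR)) idle)).

(* The tape [(u, [::])], with [u] stored nearest cell first, after one move to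
   the left. *)
Definition last_cell (u : word) : tape :=
  (behead (map Some u), push (head None (map Some u)) [::]).

Lemma exec_rewind i u m :
  exec (rewind i) (set i (map Some u, [::]) m) (size u).+2
    (set i (home (rev u)) m).
Proof.
exists (size u).+2 => //.
apply: (@runs_step (rewind i) _ false) => //.
rewrite zip_act_set get_map_set /=.
(* For the induction, the accumulator of [rev] becomes a general word [w], the part already passed
   by the head. *)
rewrite /rev; set w := (X in catrev u X).
have -> : [::] = map Some w by [].
elim: u w => [|a u IH] w /=.
  have -> : set i (home w) m = zip6 act (set i (Some (None, MoveR)) idle)
              (set i ([::], push None (map Some w)) m).
    by rewrite zip_act_set; case: w.
  by apply: runs_exit; rewrite /= get_map_set; case: w.
apply: (@runs_step (rewind i) _ false); first by rewrite /= get_map_set.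
by rewrite zip_act_set; apply: (IH (a :: w)).
Qed.

Definition is_one (a : cell) : bool := if a is Some Bit1 then true else false.

(** The state is the carry. A blank counts as the digit 0, and the head of an exhausted [Base] stays
    just after its word, ready to be rewound. *)
Definition add : component :=
  @Component bool false (fun c r =>
    let x := get Base r in let y := get Prod r in
    if [|| isSome x, isSome y | c] then
      let s := is_one x + is_one y + c in
      (Some (1 < s), set Base (if isSome x then Some (x, MoveR) else None)
                       (set Prod (Some (Some (bit (odd s)), MoveR)) idle))
    else (None, idle)).

Lemma runs_add (x y : nat) (c : bool) a e f o u v :
  runs (C := add) c (Six a (map Some u, map Some (bits x)) e f
                         (map Some v, map Some (bits y)) o)
    (size (bits (x + y + c))).+1
    (Six a (map Some (rev (bits x) ++ u), [::]) e f
         (map Some (rev (bits (x + y + c)) ++ v), [::]) o).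
Proof.
(* Strong induction on the value [x + y + c], which one step of the machine replaces by its half. *)
have [n] := ubnP (x + y + c); elim: n => // n IH in x y c u v *; rewrite ltnS => le_n.
have [z0|z_gt0] := posnP (x + y + c).
  move/eqP: z0; rewrite !addn_eq0 => /andP[/andP[/eqP-> /eqP->]].
  case: c {le_n} => // _.
  rewrite -[0 + 0 + false]/0 [bits 0]bitsE /=; set m := Six _ _ _ _ _ _; rewrite -{2}[m]idleE.
  exact: runs_exit.
have half_sum : (x + y + c)./2 = x./2 + y./2 + (1 < odd x + odd y + c).
  by move: (odd_double_half x) (odd_double_half y); case: (odd x); case: (odd y);
     case: c {z_gt0 le_n}; rewrite /=; lia.
have odd_sum : odd (x + y + c) = odd (odd x + odd y + c).
  by rewrite !oddD; case: (odd x); case: (odd y); case: c {z_gt0 le_n half_sum}.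
have head_bits k : is_one (head None (map Some (bits k))) = odd k.
  by rewrite bitsE; case: k => //= k; case: (odd k).
have some_bits k : isSome (head None (map Some (bits k))) = (0 < k).
  by rewrite bitsE; case: k.
(* [Base] advances only if [x] still has digits. *)
pose u' := if x is 0 then u else bit (odd x) :: u.
have := IH x./2 y./2 (1 < odd x + odd y + c) u' (bit (odd (x + y + c)) :: v).
rewrite -half_sum => /(_ _) run_half.
have {}run_half := run_half ltac:(lia).
have -> : rev (bits x) ++ u = rev (bits x./2) ++ u'.
  by rewrite /u' {1}bitsE; case: (x) => // k; rewrite rev_cons cat_rcons.
have Ez : bits (x + y + c) = bit (odd (x + y + c)) :: bits (x + y + c)./2.
  by rewrite {1}bitsE; case: (_ + _) z_gt0.
rewrite {1 2}Ez rev_cons cat_rcons [size _]/=.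
apply: runs_step.
  rewrite /= /read /= !head_bits !some_bits.
  have -> : [|| 0 < x, 0 < y | c] by move: z_gt0; rewrite !addn_gt0 lt0b orbA.
  by rewrite -odd_sum.
move: run_half; congr runs; rewrite /=.
congr (Six _ _ _ _ _ _).
  by rewrite /u' {2}[bits x]bitsE {1}[bits x]bitsE; case: (x).
by congr pair; rewrite [in RHS]bitsE; case: (y).
Qed.

(** The least significant digit is leftmost, so doubling prepends a zero; the empty word stands for
    0 and must stay empty. *)
Definition double : component :=
  @Component bool true (fun s r =>
    if s then
      if isSome (get Prod r) then
        (Some false, set Prod (Some (get Prod r, MoveL)) idle)
      else (None, idle)
    else (None, set Prod (Some (Some Bit0, Stay)) idle)).

Lemma exec_double y a b e f o :
  exec double (Six a b e f (home (bits y)) o) 2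
              (Six a b e f (home (bits y.*2)) o).
Proof.
rewrite [bits y.*2]bitsE; case: y => [|y].
  rewrite bitsE; set m := Six _ _ _ _ _ _; exists 1%N => //.
  by rewrite -{2}[m]idleE; apply: runs_exit.
rewrite /home bitsE /= odd_double doubleK; exists 2%N => //.
apply: (@runs_step double _ false) => //=.
rewrite [bits y.+1]bitsE; by apply: runs_last; [reflexivity|].
Qed.

Definition then_add : component :=
  then_ add (then_ (rewind Base) (rewind Prod)).

Lemma exec_then_add x y a e f o M :
  size (bits (x + y)) <= M ->
  exec then_add (Six a (home (bits x)) e f (home (bits y)) o) (3 * M + 5)
                (Six a (home (bits x)) e f (home (bits (x + y))) o).
Proof.
move=> le_M; have le_x : size (bits x) <= M.
  by apply: leq_trans le_M; apply/leq_size_bits/leq_addr.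
have := @runs_add x y false a e f o [::] [::]; rewrite addn0 !cats0.
move/(exec_runs (C := add)) => exec1.
have := exec_rewind Base (rev (bits x))
  (Six a blank e f (map Some (rev (bits (x + y))), [::]) o).
have := exec_rewind Prod (rev (bits (x + y))) (Six a (home (bits x)) e f blank o).
rewrite !revK !size_rev => exec3 exec2.
by apply: exec_le (exec_then exec1 (exec_then exec2 exec3)) _; lia.
Qed.

(* Horner's rule, from the most significant bit of the number on [Fac]. *)
Definition mul_step : component :=
  then_ double
    (then_ (when (fun r => is_one (get Fac r)) then_add)
       (once (fun _ => set Fac (Some (None, MoveL)) idle))).

Definition step_left (i : tape_name) : component :=
  once (fun r => set i (Some (get i r, MoveL)) idle).

Definition mul : component :=
  then_ (step_left Fac) (while (fun r => isSome (get Fac r)) mul_step).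

Definition horner_step (b v : nat) (c : bool) : nat := v.*2 + c * b.

(** The accumulator never decreases, so the length of the final product bounds all intermediate
    ones, and one [M] serves every iteration. *)
Lemma leq_horner b v s : v <= foldl (horner_step b) v s.
Proof.
elim: s v => //= c s IH v; apply: leq_trans (IH _).
by rewrite /horner_step; lia.
Qed.

Lemma exec_mul_loop b v (s : seq bool) a e o M :
  0 < b -> size (bits (foldl (horner_step b) v s)) <= M ->
  exec (while (fun r => isSome (get Fac r)) mul_step)
    (Six a (home (bits b)) e (last_cell (map bit s)) (home (bits v)) o)
    (size s * (3 * M + 10)).+1
    (Six a (home (bits b)) e blank (home (bits (foldl (horner_step b) v s))) o).
Proof.
move=> b_gt0; elim: s v => [|c s IH] v le_M; first exact: exec_while_false.
have {}IH := IH (horner_step b v c) le_M.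
set m := Six _ _ _ _ _ _.
have exec1 := exec_double v a (home (bits b)) e (last_cell (map bit (c :: s))) o.
have exec2 : exec (when (fun r => is_one (get Fac r)) then_add)
    (Six a (home (bits b)) e (last_cell (map bit (c :: s))) (home (bits v.*2)) o)
    (3 * M + 6)
    (Six a (home (bits b)) e (last_cell (map bit (c :: s)))
         (home (bits (horner_step b v c))) o).
  have := leq_horner b (horner_step b v c) s.
  move/leq_size_bits/leq_trans => /(_ _ le_M).
  rewrite /horner_step; case: c {IH le_M exec1 m} => le_M.
    rewrite mul1n addnC addnS in le_M *.
    by apply: exec_when_true => //; apply: exec_then_add.
  by rewrite mul0n addn0; apply: exec_le (exec_when_false _ _) _ => //; lia.
have exec3 : exec (once (fun _ => set Fac (Some (None, MoveL)) idle))
    (Six a (home (bits b)) e (last_cell (map bit (c :: s)))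
         (home (bits (horner_step b v c))) o) 1
    (Six a (home (bits b)) e (last_cell (map bit s))
         (home (bits (horner_step b v c))) o).
  have -> : last_cell (map bit s) =
    act (Some (None, MoveL)) (last_cell (map bit (c :: s))) by case: (s).
  exact: exec_once.
have tm : isSome (get Fac (map6 read m)) by rewrite /m; case: (c).
apply: exec_le (exec_while_true tm (exec_then exec1 (exec_then exec2 exec3)) IH) _.
by rewrite /=; lia.
Qed.

Lemma foldl_horner b n :
  exists2 s, rev (bits n) = map bit s & foldl (horner_step b) 0 s = n * b.
Proof.
exists (rev (mkseq (fun i => odd (n %/ 2 ^ i)) (up_log 2 n.+1))).
  by rewrite map_rev -map_comp.
(* As a right fold, the recursion splits off the lowest digit, which matches halving [n]. *)
rewrite foldl_rev; have [m] := ubnP n; elim: m => // m IH in n *.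
rewrite ltnS => le_nm; case: n le_nm => [|n] le_nm; first by rewrite up_log1.
rewrite up_log2S // /mkseq /= divn1 (iotaDl 1 0) -map_comp.
rewrite (@eq_map _ _ _ (fun i => odd (n.+1./2 %/ 2 ^ i))) => [|i /=]; last first.
  by rewrite expnS divnMA divn2.
rewrite IH; last by lia.
by rewrite /horner_step -[n.+1 in RHS]odd_double_half /=; lia.
Qed.

Lemma exec_mul b n a e o M :
  0 < b -> size (bits (n * b)) <= M ->
  exec mul
    (Six a (home (bits b)) e (spent (bits n)) blank o)
    (size (bits n) * (3 * M + 10) + 2)
    (Six a (home (bits b)) e blank (home (bits (n * b))) o).
Proof.
move=> b_gt0; have [s Es <-] := foldl_horner b n => le_M.
have -> : size (bits n) = size s by rewrite -size_rev Es size_map.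
rewrite addn2 -add1n; apply: exec_then; first exact: exec_once.
rewrite /spent Es /=.
have := @exec_mul_loop b 0 s a e o M b_gt0 le_M.
by rewrite bitsE; congr exec; congr Six; rewrite /last_cell; case: (s).
Qed.

(** Each round erases one mark of the unary exponent; the transfer leaves [Fac] in the position from
    which [mul] starts. *)
Definition pow_step : component :=
  then_ mul (then_ (transfer predT Prod Fac)
    (once (fun _ => set Exp (Some (None, MoveL)) idle))).

Definition pow : component :=
  then_ (step_left Exp) (while (fun r => isSome (get Exp r)) pow_step).

Lemma exec_pow_loop b n k a o M :
  0 < b -> size (bits (n * b ^ k)) <= M ->
  exec (while (fun r => isSome (get Exp r)) pow_step)
    (Six a (home (bits b)) (last_cell (nseq k Bit1)) (spent (bits n)) blank o)
    (k * (M * (3 * M + 11) + 5)).+1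
    (Six a (home (bits b)) blank (spent (bits (n * b ^ k))) blank o).
Proof.
move=> b_gt0; elim: k n => [|k IH] n le_M.
  by rewrite muln1; apply: exec_while_false.
(* Since [b] is positive, intermediate products are no longer than the final one. *)
have le_nbM : size (bits (n * b)) <= M.
  apply: leq_trans le_M; apply: leq_size_bits.
  by rewrite leq_mul2l expnS leq_pmulr ?orbT // expn_gt0 b_gt0.
have le_nM : size (bits n) <= M.
  by apply: leq_trans le_nbM; apply: leq_size_bits; rewrite leq_pmulr.
rewrite expnS mulnA in le_M *.
have {}IH := IH _ le_M.
set m := Six _ _ _ _ _ _.
have exec1 := exec_mul a (last_cell (nseq k.+1 Bit1)) o b_gt0 le_nbM.
have := @exec_transfer predT Prod Fac (bits (n * b)) [::] [::]
  (Six a (home (bits b)) (last_cell (nseq k.+1 Bit1)) blank blank o) isT.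
rewrite /= !cats0 => /(_ _ isT) exec2.
have {}exec2 := exec2 (all_predT _).
have exec3 : exec (once (fun _ => set Exp (Some (None, MoveL)) idle))
    (Six a (home (bits b)) (last_cell (nseq k.+1 Bit1))
         (spent (bits (n * b))) blank o) 1
    (Six a (home (bits b)) (last_cell (nseq k Bit1))
         (spent (bits (n * b))) blank o).
  have -> : last_cell (nseq k Bit1) =
    act (Some (None, MoveL)) (last_cell (nseq k.+1 Bit1)) by case: (k).
  exact: exec_once.
have tm : isSome (get Exp (map6 read m)) by [].
apply: exec_le (exec_while_true tm (exec_then exec1 (exec_then exec2 exec3)) IH) _.
have := leq_mul le_nM (leqnn (3 * M + 10)); lia.
Qed.

Lemma exec_pow b n k a o M :
  0 < b -> size (bits (n * b ^ k)) <= M ->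
  exec pow
    (Six a (home (bits b)) (spent (nseq k Bit1)) (spent (bits n)) blank o)
    (k * (M * (3 * M + 11) + 5) + 2)
    (Six a (home (bits b)) blank (spent (bits (n * b ^ k))) blank o).
Proof.
move=> b_gt0 le_M; rewrite addn2 -add1n; apply: exec_then; first exact: exec_once.
have -> : spent (nseq k Bit1) = (map Some (nseq k Bit1), [::]).
  congr (map _ _, _).
  by elim: k {le_M} => // k IH; rewrite -[in LHS]addn1 nseqD rev_cat IH.
have := @exec_pow_loop b n k a o M b_gt0 le_M; rewrite /=.
by congr exec; congr Six; rewrite /last_cell; case: (k).
Qed.

(** * The substitution machine *)

Definition port (b : nat) (i o : word) : memory :=
  Six (home i) (home (bits b)) blank blank blank (spent o).

(** Quantifying over the remaining input [i] and the earlier output [o] lets stages be chained in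
    any context. *)
Definition translates (b : nat) (C : component) (w w' : word) (n : nat) : Prop :=
  forall i o, exec C (port b (w ++ i) o) n (port b i (o ++ w')).

Lemma translates_le b C w w' n n' :
  translates b C w w' n -> n <= n' -> translates b C w w' n'.
Proof. by move=> Cw le_nn' i o; apply: exec_le (Cw i o) le_nn'. Qed.

Lemma translates_then b C1 C2 w1 w2 w1' w2' n1 n2 :
  translates b C1 w1 w1' n1 -> translates b C2 w2 w2' n2 ->
  translates b (then_ C1 C2) (w1 ++ w2) (w1' ++ w2') (n1 + n2).
Proof.
move=> C1w C2w i o; rewrite -catA; apply: exec_then (C1w _ _) _.
by rewrite catA; apply: C2w.
Qed.

Definition skip : component := once (fun _ => set In (Some (None, MoveR)) idle).

Definition copy : component :=
  once (fun r => set In (Some (None, MoveR)) (set Out (Some (get In r, MoveR)) idle)).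

Lemma translates_skip b a : translates b skip [:: a] [::] 1.
Proof. by move=> i o; rewrite cats0; apply: exec_once. Qed.

Lemma spent_cat1 w a : spent (w ++ [:: a]) = (Some a :: map Some (rev w), [::]).
Proof. by rewrite /spent rev_cat. Qed.

Lemma translates_copy b a : translates b copy [:: a] [:: a] 1.
Proof. by move=> i o; rewrite /port spent_cat1; apply: exec_once. Qed.

Definition copy_bits : component := transfer isbit In Out.

Lemma exec_copy_bits b w a i o : all isbit w -> ~~ isbit a ->
  exec copy_bits (port b (w ++ a :: i) o) (size w).+1 (port b (a :: i) (o ++ w)).
Proof.
move=> bits_w nbit_a.
have := @exec_transfer isbit In Out w (Some a :: map Some i) (rev o)
  (port b [::] [::]) isT bits_w nbit_a.
by rewrite /port /home /spent rev_cat [map _ (w ++ _)]map_cat.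
Qed.

Definition copy_number : component := then_ copy (then_ copy_bits copy).

Lemma translates_copy_number b w : all isbit w ->
  translates b copy_number (bracket w) (bracket w) (size w + 3).
Proof.
move=> bits_w i o; rewrite /bracket -cats1 -cat1s -!catA.
have exec1 := translates_copy b Open (w ++ Close :: i) o.
have exec2 := @exec_copy_bits b w Close i (o ++ [:: Open]) bits_w isT.
have exec3 := translates_copy b Close i ((o ++ [:: Open]) ++ w).
rewrite -!catA in exec1 exec2 exec3.
by apply: exec_le (exec_then exec1 (exec_then exec2 exec3)) _; lia.
Qed.

Definition copy_bracket (C : component) : component := then_ copy (then_ C copy).

Lemma translates_bracket b C w w' n : translates b C w w' n ->
  translates b (copy_bracket C) (bracket w) (bracket w') n.+2.
Proof.
move=> Cw; rewrite /bracket -!cats1.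
have := translates_then (translates_copy b Open)
          (translates_then Cw (translates_copy b Close)).
by move/translates_le; apply; lia.
Qed.

Definition is_open (a : cell) : bool := if a is Some Open then true else false.

(** List elements are coded by bracketed words, so an [Open] under the head means that another
    element follows. *)
Definition copy_seq (C : component) : component :=
  copy_bracket (while (fun r => is_open (get In r)) C).

(** The cost is [G] per input symbol. The predecessor leaves one step per element for the loop test,
    and [1 < G] pays for the two brackets and the last test. *)
Lemma translates_seq b (X : Type) (enc enc' : X -> word) C N G s :
  (forall x, exists w, enc x = bracket w) -> 1 < G ->
  (forall x, size (enc x) <= N ->
     translates b C (enc x) (enc' x) (G * size (enc x)).-1) ->
  size (enc_seq enc s) <= N ->
  translates b (copy_seq C) (enc_seq enc s) (enc_seq enc' s)
    (G * size (enc_seq enc s)).-1.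
Proof.
move=> enc_br G_gt1 C_enc le_N i o.
have loop j u : is_open (head None (map Some j)) = false ->
    exec (while (fun r => is_open (get In r)) C)
      (port b (flatten (map enc s) ++ j) u) (G * size (flatten (map enc s))).+1
      (port b j (u ++ flatten (map enc' s))).
  move=> close_j; have : size (flatten (map enc s)) <= N.
    by apply: leq_trans le_N; rewrite /enc_seq /bracket /= size_rcons; lia.
  elim: s u {le_N} => [|x s IH] u /=.
    rewrite cats0 => _; apply: exec_le (exec_while_false _ _) _ => //.
    by rewrite /= /read /= close_j.
  rewrite size_cat => le_N; rewrite -catA mulnDr [u ++ _]catA.
  have [w Ew] := enc_br x.
  have exec1 := C_enc x ltac:(lia) (flatten (map enc s) ++ j) u.
  have exec2 := IH (u ++ enc' x) ltac:(lia).
  apply: exec_le (exec_while_true _ exec1 exec2) _; first by rewrite Ew.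
  have : 0 < G * size (enc x) by rewrite muln_gt0 Ew /= (ltnW G_gt1).
  by lia.
have size_enc : size (enc_seq enc s) = (size (flatten (map enc s))).+2.
  by rewrite /enc_seq /bracket /= size_rcons.
rewrite size_enc /enc_seq /bracket -!cats1 -cat1s -!catA.
have exec1 := translates_copy b Open (flatten (map enc s) ++ Close :: i) o.
have exec2 := loop (Close :: i) (o ++ [:: Open]) erefl.
have exec3 := translates_copy b Close i ((o ++ [:: Open]) ++ flatten (map enc' s)).
rewrite -!catA in exec1 exec2 exec3 *.
apply: exec_le (exec_then exec1 (exec_then exec2 exec3)) _.
by rewrite !mulnS; lia.
Qed.

Fixpoint repeat (n : nat) (C : component) : component :=
  if n is n'.+1 then then_ C (repeat n' C) else once (fun _ => idle).

Lemma translates_copy_numbers b (s : seq nat) :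
  translates b (repeat (size s) copy_number) (flatten (map enc_unary s))
    (flatten (map enc_unary s)) (2 * size (flatten (map enc_unary s))).+1.
Proof.
elim: s => [|n s IH] /=.
  move=> i o; rewrite cats0 -{2}[port b i o]idleE; exact: exec_once.
apply: translates_le (translates_then (translates_copy_number _ _) IH) _.
  by rewrite all_nseq orbT.
by rewrite size_cat /= size_rcons; lia.
Qed.

(** The head starts at the last exponent of a term. This exponent moves to [Exp], the brackets and
    the sign bit are copied, and the absolute value of the coefficient goes to [Fac]. *)
Definition scale : component :=
  then_ skip (then_ (transfer isbit In Exp) (then_ skip
 (then_ copy (then_ copy (then_ copy (then_ (transfer isbit In Fac)
 (then_ pow (then_ (rewind Fac) (then_ (transfer isbit Fac Out) copy))))))))).

Lemma translates_scale b e n sg M :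
  0 < b -> size (bits (n * b ^ e)) <= M ->
  translates b scale
    (enc_unary e ++ [:: Close; Open; sg] ++ bits n ++ [:: Close])
    ([:: Close; Open; sg] ++ bits (n * b ^ e) ++ [:: Close])
    (e * (M * (3 * M + 11) + 6) + 3 * M + 14).
Proof.
move=> b_gt0 le_M i o.
have le_nM : size (bits n) <= M.
  by apply: leq_trans le_M; apply: leq_size_bits; rewrite leq_pmulr // expn_gt0 b_gt0.
rewrite /enc_unary /bracket -cats1 -[Open :: _ ++ _]cat1s -!catA.
have ones : all isbit (nseq e Bit1) by rewrite all_nseq orbT.
pose rest := [:: Close, Close, Open, sg & bits n ++ Close :: i].
have := translates_skip b Open (nseq e Bit1 ++ rest) o; rewrite cats0 => exec1.
have := @exec_transfer isbit In Exp (nseq e Bit1) (map Some rest) [::]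
  (port b [::] o) isT ones isT.
rewrite cats0 -map_cat size_nseq => exec2.
pose m1 j u f := Six (home j) (home (bits b)) (spent (nseq e Bit1)) f blank (spent u).
pose m2 j u f := Six (home j) (home (bits b)) blank f blank (spent u).
have exec3 : exec skip (m1 rest o blank) 1 (m1 (behead rest) o blank).
  exact: exec_once.
have exec_copy a j u : exec copy (m1 (a :: j) u blank) 1 (m1 j (u ++ [:: a]) blank).
  by rewrite /m1 spent_cat1; apply: exec_once.
have exec4 := exec_copy Close [:: Open, sg & bits n ++ Close :: i] o.
have exec5 := exec_copy Open (sg :: bits n ++ Close :: i) (o ++ [:: Close]).
have exec6 := exec_copy sg (bits n ++ Close :: i) ((o ++ [:: Close]) ++ [:: Open]).
rewrite -!catA in exec4 exec5 exec6.
set o1 := o ++ [:: Close] ++ [:: Open] ++ [:: sg] in exec6.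
have := @exec_transfer isbit In Fac (bits n) (map Some (Close :: i)) [::]
  (m1 [::] o1 blank) isT (all_isbit_bits _) isT.
rewrite cats0 -map_cat => exec7.
have exec8 := exec_pow (home (Close :: i)) (spent o1) b_gt0 le_M.
have := exec_rewind Fac (rev (bits (n * b ^ e))) (m2 (Close :: i) o1 blank).
rewrite revK size_rev => exec9.
have := @exec_transfer isbit Fac Out (bits (n * b ^ e)) [::] (rev o1)
  (m2 (Close :: i) [::] blank) isT (all_isbit_bits _) isT.
rewrite cats0 -rev_cat => exec10.
have exec11 := translates_copy b Close i (o1 ++ bits (n * b ^ e)).
have := exec_then exec1 (exec_then exec2 (exec_then exec3 (exec_then exec4
  (exec_then exec5 (exec_then exec6 (exec_then exec7 (exec_then exec8
  (exec_then exec9 (exec_then exec10 exec11))))))))).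
rewrite /o1 -!catA => exec_all; apply: exec_le exec_all _.
by rewrite [e * (_ + 6)]mulnDr [e * (_ + 5)]mulnDr; lia.
Qed.

(** * Translating terms, polynomials and rational functions *)

Lemma multinom_rcons k (m : 'X_{1..k.+1}) :
  (m : seq nat) = rcons [multinom m (lift ord_max i) | i < k] (m ord_max).
Proof.
apply: (@eq_from_nth _ 0) => [|i]; first by rewrite size_rcons !size_tuple.
rewrite size_tuple => lt_i; rewrite nth_rcons size_tuple.
have -> : nth 0 m i = m (Ordinal lt_i) by rewrite -(tnth_nth 0 _ (Ordinal _)).
have [lt_ik|le_ki] := ltnP i k.
  have -> : nth 0 [multinom m (lift ord_max j) | j < k] i =
    [multinom m (lift ord_max j) | j < k] (Ordinal lt_ik).
    by rewrite -(tnth_nth 0 _ (Ordinal _)).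
  by rewrite mnmE; congr (fun_of_multinom m _); apply: val_inj; rewrite /= /bump leqNgt lt_ik.
have -> : i == k by rewrite eqn_leq le_ki -ltnS lt_i.
by congr (fun_of_multinom m _); apply: val_inj => /=; apply/eqP; rewrite eqn_leq le_ki -ltnS lt_i.
Qed.

Definition enc_term k : term k -> word := enc_pair (@enc_monomial k) enc_int.

Lemma enc_intE z : enc_int z = [:: Open, bit (z < 0)%R & bits `|z|%N ++ [:: Close]].
Proof. by rewrite /enc_int /bracket /= cats1. Qed.

(** The grouping follows the stages of [term_machine]: the exponent of the substituted variable ends
    its list and so directly precedes the coefficient. *)
Lemma enc_termE k (u : term k.+1) :
  enc_term u = [:: Open; Open]
    ++ flatten (map enc_unary [multinom u.1 (lift ord_max i) | i < k])
    ++ (enc_unary (u.1 ord_max)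
        ++ [:: Close; Open; bit (u.2 < 0)%R] ++ bits `|u.2|%N ++ [:: Close])
    ++ [:: Close].
Proof.
rewrite /enc_term /enc_pair /enc_monomial /enc_seq multinom_rcons enc_intE.
by rewrite map_rcons flatten_rcons /bracket -!cats1 -!catA /= -!catA /= -!catA.
Qed.

Lemma enc_subst_term k b (u : term k.+1) : 0 < b ->
  enc_term (subst_term b u) = [:: Open; Open]
    ++ flatten (map enc_unary [multinom u.1 (lift ord_max i) | i < k])
    ++ ([:: Close; Open; bit (u.2 < 0)%R]
        ++ bits (`|u.2| * b ^ u.1 ord_max)%N ++ [:: Close])
    ++ [:: Close].
Proof.
move=> b_gt0; rewrite /enc_term /enc_pair /enc_monomial /enc_seq enc_intE.
rewrite /bracket -!cats1 -!catA /= -!catA /= abszM absz_nat.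
(* The power of [b] is positive, so the sign bit is unchanged. *)
by rewrite Num.Theory.pmulr_llt0 // ltz_nat expn_gt0 b_gt0.
Qed.

(** If the coefficient and [b] have at most [N] bits and the exponent is at most [N], the power has
    at most [N * N + 1] bits and the product at most [N] more. *)
Definition len_bound (N : nat) : nat := N * N + N + 1.
Definition unit_cost (N : nat) : nat :=
  len_bound N * (3 * len_bound N + 11) + 20.

Lemma unit_cost_gt1 N : 1 < unit_cost N.
Proof. by rewrite /unit_cost; lia. Qed.

Definition term_machine (k : nat) : component :=
  then_ copy (then_ copy (then_ (repeat k copy_number) (then_ scale copy))).

Lemma translates_term k b N (u : term k.+1) :
  0 < b -> size (bits b) <= N -> size (enc_term u) <= N ->
  translates b (term_machine k) (enc_term u) (enc_term (subst_term b u))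
    (unit_cost N * size (enc_term u)).-1.
Proof.
move=> b_gt0 le_bN le_uN; set F := flatten (map enc_unary
  [multinom u.1 (lift ord_max i) | i < k]).
set e := u.1 ord_max; set n := `|u.2|%N.
have size_u : size (enc_term u) = size F + e + size (bits n) + 9.
  rewrite enc_termE /enc_unary /bracket -cats1 !size_cat /= size_cat size_nseq /=.
  by rewrite -/F -/e -/n; lia.
have le_M : size (bits (n * b ^ e)) <= len_bound N.
  apply: leq_trans (size_bitsM _ _) _; have := size_bitsX b e.
  have : e * size (bits b) <= N * N by apply: leq_mul => //; lia.
  by rewrite /len_bound; lia.
rewrite size_u enc_termE (enc_subst_term _ b_gt0) -/F -/e -/n.
have nums := translates_copy_numbers b [multinom u.1 (lift ord_max i) | i < k].
rewrite size_tuple -/F in nums.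
have scale_n := translates_scale (bit (u.2 < 0)%R) b_gt0 le_M.
apply: translates_le (translates_then (translates_copy b Open)
  (translates_then (translates_copy b Open)
  (translates_then nums (translates_then scale_n (translates_copy b Close))))) _.
rewrite /unit_cost; set M := len_bound N; have : 11 * M <= M * (3 * M + 11).
  by rewrite mulnDr mulnC leq_addl.
move: (M * (3 * M + 11)) => Q le_MQ; nia.
Qed.

Definition poly_machine (k : nat) : component := copy_seq (term_machine k).

Lemma translates_poly k b N (p : poly_code k.+1) :
  0 < b -> size (bits b) <= N -> size (enc_poly p) <= N ->
  translates b (poly_machine k) (enc_poly p) (enc_poly (subst_poly b p))
    (unit_cost N * size (enc_poly p)).-1.
Proof.
move=> b_gt0 le_bN le_pN.
have -> : enc_poly (subst_poly b p) = enc_seq (fun u => enc_term (subst_term b u)) p.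
  by rewrite /enc_poly /enc_seq /subst_poly -map_comp.
apply: translates_seq le_pN => [u||u le_uN]; last exact: translates_term.
  by rewrite /enc_pair; eexists.
exact: unit_cost_gt1.
Qed.

Definition ratfun_machine (k : nat) : component :=
  copy_bracket (then_ (poly_machine k) (poly_machine k)).

Lemma translates_ratfun k b N (f : ratfun_code k.+1) :
  0 < b -> size (bits b) <= N -> size (enc_ratfun f) <= N ->
  translates b (ratfun_machine k) (enc_ratfun f) (enc_ratfun (subst_ratfun b f))
    (unit_cost N * size (enc_ratfun f)).-1.
Proof.
move=> b_gt0 le_bN.
have -> : size (enc_ratfun f) = size (enc_poly f.1) + size (enc_poly f.2) + 2.
  by rewrite /enc_ratfun /enc_pair /bracket /= size_rcons size_cat addn2.
move=> le_fN.
have poly1 := @translates_poly k b N f.1 b_gt0 le_bN ltac:(lia).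
have poly2 := @translates_poly k b N f.2 b_gt0 le_bN ltac:(lia).
apply: translates_le (translates_bracket (translates_then poly1 poly2)) _.
by rewrite !mulnDr; have := unit_cost_gt1 N; lia.
Qed.

(** * Translating a whole instance *)

Definition erase_last (i : tape_name) : component :=
  then_ (step_left i) (once (fun _ => set i (Some (None, Stay)) idle)).

Definition values_machine (k : nat) : component := copy_seq (ratfun_machine k).

(** After the values and the target, the rest of the input is copied verbatim. This includes the
    closing bracket of the pair formed by [b] and the instance, which [erase_last] removes. *)
Definition subst_machine (k : nat) : component :=
  then_ skip (then_ skip (then_ (transfer isbit In Base) (then_ (rewind Base)
 (then_ skip (then_ copy (then_ (values_machine k) (then_ (ratfun_machine k)
 (then_ (transfer predT In Out) (then_ (erase_last Out) (rewind Out)))))))))).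

Lemma exec_erase_last c w m :
  exec (erase_last Out) (set Out (spent (rcons w c)) m) 2 (set Out (spent w) m).
Proof.
rewrite /spent rev_rcons; case: m => a b e f p o /=.
exact: exec_then (exec_once _ _) (exec_once _ _).
Qed.

(** A left half-tape grows by at most one cell per step, so the time of the earlier stages bounds
    the length of the output that the final rewind crosses. *)
Lemma size_left_exec i C m n m' :
  exec C m n m' -> size (get i m').1 <= size (get i m).1 + n.
Proof.
case=> p le_pn run_p.
suff : size (get i m').1 <= size (get i m).1 + p by move/leq_trans; apply; rewrite leq_add2l.
have size_act a t : size (act a t).1 <= (size t.1).+1.
  case: a t => [[c []]|] [l r] //=; first by rewrite size_behead; lia.
  by case: c l => [c|] [|c' l].
elim: run_p => {n m m' p le_pn} [s m a _|s s' m a n m' _ _ IH].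
  by rewrite get_zip6 addn1.
by apply: leq_trans IH _; rewrite get_zip6 addnS -addSn leq_add2r.
Qed.

Lemma enc_instanceE k v (I : instance k v) :
  enc_instance I = [:: Open] ++ enc_seq (@enc_ratfun k) (inst_values I)
    ++ enc_ratfun (inst_target I) ++ enc_extra (inst_extra I) ++ [:: Close].
Proof. by rewrite /enc_instance /bracket -cats1 -!catA. Qed.

Lemma exec_subst_machine k v b (I : instance k.+1 v) :
  let w := enc_pair enc_nat (@enc_instance k.+1 v) (b, I) in
  let N := size w in
  0 < b ->
  exec (subst_machine k) (Six (home w) blank blank blank blank blank)
    (2 * (unit_cost N * N) + 8 * N + 30)
    (Six blank (home (bits b)) blank blank blank
         (home (enc_instance (subst_instance b I)))).
Proof.
move=> w N b_gt0.
pose vals := enc_seq (@enc_ratfun k.+1) (inst_values I).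
pose targ := enc_ratfun (inst_target I).
(* This [Close] ends the instance; the one added in [rest] ends the pair. *)
pose ext := enc_extra (inst_extra I) ++ [:: Close].
pose rest := [:: Open] ++ vals ++ targ ++ ext ++ [:: Close].
have Ew : w = Open :: Open :: bits b ++ Close :: rest.
  rewrite /w /enc_pair enc_instanceE /enc_nat /bracket -!cats1 /=.
  by rewrite /rest /ext; do 3!rewrite -?catA /=.
have size_w : N = size (bits b) + size vals + size targ + size (enc_extra (inst_extra I)) + 6.
  rewrite /N Ew /rest /ext; clear rest ext Ew; move: vals targ => V T.
  by rewrite /= size_cat /= !size_cat /= ?size_cat /=; lia.
pose vals' := enc_seq (@enc_ratfun k) (inst_values (subst_instance b I)).
pose targ' := enc_ratfun (inst_target (subst_instance b I)).
pose m0 j b' := Six (home j) b' blank blank blank blank.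
have exec_skip j b' : exec skip (m0 (Open :: j) b') 1 (m0 j b').
  exact: exec_once.
have exec_skip_close j b' : exec skip (m0 (Close :: j) b') 1 (m0 j b').
  exact: exec_once.
have exec1 := exec_skip (Open :: bits b ++ Close :: rest) blank.
have exec2 := exec_skip (bits b ++ Close :: rest) blank.
have := @exec_transfer isbit In Base (bits b) (map Some (Close :: rest)) [::]
  (m0 [::] blank) isT (all_isbit_bits _) isT.
rewrite cats0 -map_cat => exec3.
have := exec_rewind Base (rev (bits b)) (m0 (Close :: rest) blank).
rewrite revK size_rev => exec4.
have exec5 := exec_skip_close rest (home (bits b)).
have exec6 := translates_copy b Open (vals ++ targ ++ ext ++ [:: Close]) [::].
have exec7 : exec (values_machine k)
    (port b (vals ++ targ ++ ext ++ [:: Close]) [:: Open]) (unit_cost N * size vals)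
    (port b (targ ++ ext ++ [:: Close]) ([:: Open] ++ vals')).
  have -> : vals' = enc_seq (fun f => enc_ratfun (subst_ratfun b f)) (inst_values I).
    by rewrite /vals' /enc_seq -map_comp.
  suff vals_tr : translates b (values_machine k) vals
      (enc_seq (fun f => enc_ratfun (subst_ratfun b f)) (inst_values I))
      (unit_cost N * size vals).-1.
    by apply: exec_le (vals_tr _ _) (leq_pred _).
  apply: (@translates_seq _ _ _ _ _ N) => [f||f le_fN|].
  - by rewrite /enc_ratfun /enc_pair; eexists.
  - exact: unit_cost_gt1.
  - by apply: translates_ratfun => //; lia.
  by rewrite -/vals; lia.
have exec8 : exec (ratfun_machine k)
    (port b (targ ++ ext ++ [:: Close]) ([:: Open] ++ vals')) (unit_cost N * size targ)
    (port b (ext ++ [:: Close]) (([:: Open] ++ vals') ++ targ')).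
  have targ_tr := @translates_ratfun k b N (inst_target I) b_gt0 ltac:(lia).
  by apply: exec_le (targ_tr _ _ _) (leq_pred _); rewrite -/targ; lia.
rewrite -[([:: Open] ++ vals') ++ targ']catA in exec8.
pose o1 := [:: Open] ++ vals' ++ targ'.
have := @exec_transfer predT In Out (ext ++ [:: Close]) [::] (rev o1)
  (port b [::] [::]) isT (all_predT _) isT.
rewrite cats0 -rev_cat => exec9.
have := @exec_erase_last Close (o1 ++ ext) (port b [::] [::]).
rewrite -cats1 -catA => exec10.
have := exec_rewind Out (rev (o1 ++ ext)) (port b [::] [::]).
rewrite revK => exec11.
have := exec_then exec1 (exec_then exec2 (exec_then exec3 (exec_then exec4
  (exec_then exec5 (exec_then exec6 (exec_then exec7 (exec_then exec8
  (exec_then exec9 (exec_then exec10 exec11))))))))).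
rewrite -Ew => exec_all.
have /(size_left_exec Out) := exec_then exec1 (exec_then exec2 (exec_then exec3
  (exec_then exec4 (exec_then exec5 (exec_then exec6 (exec_then exec7 exec8)))))).
rewrite -[get Out (port _ _ _)]/(spent o1) -[size (get Out (m0 _ _)).1]/0.
rewrite /spent size_map size_rev => size_o1.
have -> : enc_instance (subst_instance b I) = o1 ++ ext.
  by rewrite enc_instanceE /o1 /ext -!catA.
apply: exec_le exec_all _.
have := leq_mul (leqnn (unit_cost N)) (_ : size vals + size targ <= N).
rewrite mulnDr => /(_ ltac:(lia)).
have size_ext : size ext = size (enc_extra (inst_extra I)) + 1 by rewrite size_cat.
by rewrite size_rev (size_cat ext) (size_cat o1) size_ext -[size [:: Close]]/1; lia.
Qed.

(** * Computing the bound *)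

Definition bound_machine : component :=
  then_ (once (fun _ => set Out (Some (Some Open, MoveR)) idle))
    (then_ (while (fun r => isSome (get In r))
              (once (fun _ => set In (Some (None, MoveR))
                                (set Out (Some (Some Bit0, MoveR)) idle))))
      (then_ (once (fun _ => set Out (Some (Some Bit1, MoveR)) idle))
        (then_ (once (fun _ => set Out (Some (Some Close, MoveR)) idle))
           (rewind Out)))).

(** With the least significant digit first, the bound is written by emitting one zero per input
    symbol and then a one. *)
Lemma bits_exp2 n : bits (2 ^ n) = rcons (nseq n Bit0) Bit1.
Proof.
elim: n => [|n IH]; first by rewrite bitsE [bits 1./2]bitsE.
rewrite bitsE expnS; case E: (2 * 2 ^ n) => [|k]; first by have := expn_gt0 2 n; lia.
by rewrite -E mul2n odd_double doubleK IH.
Qed.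

Lemma exec_bound_machine w :
  exec bound_machine (Six (home w) blank blank blank blank blank) (3 * size w + 9)
    (Six blank blank blank blank blank (home (enc_nat (2 ^ size w)))).
Proof.
pose m j o := Six (home j) blank blank blank blank (spent o).
pose put c := once (fun _ => set Out (Some (Some c, MoveR)) idle).
have exec_put c j o : exec (put c) (m j o) 1 (m j (rcons o c)).
  rewrite /m /spent rev_rcons; exact: exec_once.
have loop o : exec (while (fun r => isSome (get In r))
              (once (fun _ => set In (Some (None, MoveR))
                                (set Out (Some (Some Bit0, MoveR)) idle))))
    (m w o) (2 * size w).+1 (m [::] (o ++ nseq (size w) Bit0)).
  elim: w o => [|c w IH] o; first by rewrite cats0; apply: exec_while_false.
  have -> : o ++ nseq (size (c :: w)) Bit0 = rcons o Bit0 ++ nseq (size w) Bit0.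
    by rewrite -cats1 -catA.
  have exec1 : exec (once (fun _ => set In (Some (None, MoveR))
      (set Out (Some (Some Bit0, MoveR)) idle))) (m (c :: w) o) 1 (m w (rcons o Bit0)).
    by rewrite /m /spent rev_rcons; apply: exec_once.
  apply: exec_le (exec_while_true _ exec1 (IH _)) _ => //.
  by rewrite /=; lia.
pose o := rcons (rcons ([:: Open] ++ nseq (size w) Bit0) Bit1) Close.
have := exec_rewind Out (rev o) (m [::] [::]); rewrite revK size_rev => exec5.
have exec_all := exec_then (exec_put Open w [::]) (exec_then (loop [:: Open])
  (exec_then (exec_put _ _ _) (exec_then (exec_put _ _ _) exec5))).
have -> : enc_nat (2 ^ size w) = o by rewrite /enc_nat bits_exp2.
apply: exec_le exec_all _.
by rewrite /o !size_rcons size_cat size_nseq /=; lia.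
Qed.

(** * Polynomial running times *)

Lemma poly_time_machine (X Y : Type) (P : X -> Prop) (encX : X -> word)
    (encY : Y -> word) (f : X -> Y) (C : component) c d :
  (forall x, P x -> exists2 m, out6 m = home (encY (f x)) &
     exec C (Six (home (encX x)) blank blank blank blank blank)
       (c * size (encX x) ^ d + c) m) ->
  poly_time P encX encY f.
Proof.
move=> C_f; exists (machine C), c, d => x /C_f[m out_m exec_m].
exact: machine_outputs exec_m out_m.
Qed.

Lemma poly_time_bound (X : Type) (P : X -> Prop) (enc : X -> word) :
  poly_time P enc enc_nat (fun x => 2 ^ size (enc x)).
Proof.
apply: (@poly_time_machine _ _ _ _ _ _ bound_machine 9 1) => x _.
eexists; last by apply: exec_le (exec_bound_machine _) _; lia.
by [].
Qed.

Lemma poly_time_subst k v (P : nat * instance k.+1 v -> Prop) :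
  (forall BI, P BI -> 0 < BI.1) ->
  poly_time P (enc_pair enc_nat (@enc_instance k.+1 v)) (@enc_instance k v)
    (fun BI => subst_instance BI.1 BI.2).
Proof.
(* For input length [N], [unit_cost N] is at most [80 * N ^ 4], so the total is at most
   [2 * 80 * N ^ 5 + 8 * N + 30]. *)
move=> P_gt0; apply: (@poly_time_machine _ _ _ _ _ _ (subst_machine k) 300 5).
case=> b I /P_gt0 b_gt0; eexists; last first.
  apply: exec_le (exec_subst_machine I b_gt0) _.
  set N := size _; have N_gt0 : 0 < N by [].
  have le_M : len_bound N <= 3 * N ^ 2 by rewrite /len_bound; nia.
  have le_U : unit_cost N <= 80 * N ^ 4.
    have x_gt0 : 0 < N ^ 2 by rewrite expn_gt0 N_gt0.
    rewrite /unit_cost (expnD N 2 2); move: (len_bound N) (N ^ 2) x_gt0 le_M.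
    by move=> M x x_gt0 le_M; nia.
  have le_N : N <= N ^ 5 by rewrite -{1}[N]expn1 leq_pexp2l.
  have : unit_cost N * N <= 80 * N ^ 5 by rewrite [N ^ 5]expnSr mulnA leq_mul2r le_U orbT.
  lia.
by [].
Qed.

(** * Integer polynomials at a large integer *)

Import Order.TTheory GRing.Theory Num.Theory.
Local Open Scope ring_scope.

(* At the lowest nonzero coefficient, [q.[B]] is nonzero modulo [B]. *)
Lemma horner_neq0 (q : {poly int}) (B : nat) :
  (forall j, (`|(q`_j)%R| < B)%N) -> q != 0 -> q.[B%:Z] != 0.
Proof.
elim/poly_ind: q => [|q c IH] q_lt; first by rewrite eqxx.
have := q_lt 0%N; rewrite coefD coefMX coefC /= add0r => c_lt.
rewrite hornerMXaddC; have [->|c_neq0] := eqVneq c 0.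
  rewrite !addr0 !mulf_eq0 polyX_eq0 !orbF => q_neq0.
  rewrite negb_or IH //=; first by case: (B) c_lt.
  by move=> j; have := q_lt j.+1; rewrite coefD coefMX coefC addr0.
move=> _; apply/eqP => q0.
have Ec : c = - q.[B%:Z] * B%:Z by rewrite mulNr -[RHS]add0r -q0 addrAC subrr add0r.
move: c_neq0 c_lt; rewrite Ec abszM absz_nat mulf_eq0 negb_or => /andP[q_neq0 _].
by rewrite ltnNge leq_pmull // absz_gt0.
Qed.

(** * Norms of polynomial codes and nonvanishing after substitution *)

Definition norm1 k (p : poly_code k) : nat := (\sum_(u <- p) `|u.2|)%N.

Lemma mcoeff_poly_val k (p : poly_code k) m :
  (poly_val p)@_m = (\sum_(u <- p | u.1 == m) u.2)%:~R.
Proof.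
rewrite /poly_val raddf_sum rmorph_sum [RHS]big_mkcond /=.
apply: eq_bigr => u _; rewrite mcoeffZ mcoeffX.
by case: (_ == _); rewrite ?mulr1 // mulr0.
Qed.

Lemma absz_sum_norm1 k (p : poly_code k) (P : pred (term k)) :
  (`|(\sum_(u <- p | P u) u.2)%R| <= norm1 p)%N.
Proof.
rewrite /norm1; elim: p => [|u p IH]; first by rewrite !big_nil.
rewrite !big_cons; case: (P u); last by apply: leq_trans IH (leq_addl _ _).
by rewrite -lez_nat PoszD !abszE; apply: le_trans (ler_normD _ _) _; rewrite lerD2l -abszE.
Qed.

Definition init_monomial k (m : 'X_{1..k.+1}) : 'X_{1..k} :=
  [multinom m (lift ord_max i) | i < k].

Lemma monomial_eq k (m m' : 'X_{1..k.+1}) :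
  (m == m') = (init_monomial m == init_monomial m') && (m ord_max == m' ord_max).
Proof.
apply/eqP/andP => [->|[/eqP eq_init /eqP eq_last]]; first by rewrite !eqxx.
apply/mnmP => i; case: (unliftP ord_max i) => [j ->|->] //.
by have /mnmP/(_ j) := eq_init; rewrite !mnmE.
Qed.

(** The terms that agree with a monomial [m] of nonzero coefficient in all variables but the last
    form a polynomial [q], whose value at [B] is the coefficient of [init_monomial m] after the
    substitution. *)
Lemma subst_poly_neq0 k (B : nat) (p : poly_code k.+1) :
  (norm1 p < B)%N -> poly_val p != 0 -> poly_val (subst_poly B p) != 0.
Proof.
move=> lt_pB p_neq0.
have [m pm_neq0] : exists m, (poly_val p)@_m != 0.
  have := p_neq0; rewrite -msupp_eq0; case E: (msupp _) => [|m s] // _.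
  by exists m; rewrite -mcoeff_msupp E mem_head.
pose in_row (u : term k.+1) := init_monomial u.1 == init_monomial m.
pose q : {poly int} := \sum_(u <- p | in_row u) u.2 *: 'X^(u.1 ord_max).
have coef_q j : q`_j = \sum_(u <- p | in_row u && (u.1 ord_max == j)) u.2.
  rewrite /q coef_sum big_mkcondr; apply: eq_bigr => u _.
  by rewrite coefZ coefXn eq_sym; case: (_ == _); rewrite ?mulr1 // mulr0.
have q_neq0 : q != 0.
  apply: contraNneq pm_neq0 => q0; rewrite mcoeff_poly_val.
  under eq_bigl => u do rewrite monomial_eq -/(in_row u).
  by rewrite -coef_q q0 coef0.
have : q.[B%:Z] != 0.
  apply: horner_neq0 q_neq0 => j; rewrite coef_q.
  exact: leq_ltn_trans (absz_sum_norm1 _ _) lt_pB.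
apply: contraNneq => pB0.
have := mcoeff_poly_val (subst_poly B p) (init_monomial m).
rewrite pB0 mcoeff0 => /esym/eqP; rewrite intr_eq0 => /eqP <-.
rewrite /q horner_sum big_map /=; apply/eqP.
by apply: eq_bigr => u _; rewrite hornerZ hornerXn -[B%:Z]natz -natrX natz.
Qed.

(* The factor 2 absorbs the doubling of the norm in a sum. *)
Definition bounded k (s : nat) (p : {mpoly rat[k]}) : Prop :=
  exists2 c : poly_code k, p = poly_val c & (2 * norm1 c <= 2 ^ s)%N.

Definition code_opp k (p : poly_code k) : poly_code k := [seq (u.1, - u.2) | u <- p].

Definition code_mul k (p q : poly_code k) : poly_code k :=
  [seq ((u.1 + v.1)%MM, u.2 * v.2) | u <- p, v <- q].

Lemma poly_val_cat k (p q : poly_code k) :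
  poly_val (p ++ q) = poly_val p + poly_val q.
Proof. exact: big_cat. Qed.

Lemma poly_val_opp k (p : poly_code k) : poly_val (code_opp p) = - poly_val p.
Proof.
rewrite /poly_val big_map -sumrN; apply: eq_bigr => u _.
by rewrite mulrNz scaleNr.
Qed.

Lemma poly_val_mul k (p q : poly_code k) :
  poly_val (code_mul p q) = poly_val p * poly_val q.
Proof.
rewrite /poly_val /code_mul big_allpairs_dep mulr_suml; apply: eq_bigr => u _.
rewrite mulr_sumr; apply: eq_bigr => v _.
by rewrite mpolyXD intrM -scalerAl -scalerAr scalerA.
Qed.

Lemma norm1_cat k (p q : poly_code k) : norm1 (p ++ q) = (norm1 p + norm1 q)%N.
Proof. exact: big_cat. Qed.

Lemma norm1_opp k (p : poly_code k) : norm1 (code_opp p) = norm1 p.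
Proof. by rewrite /norm1 big_map; apply: eq_bigr => u _; rewrite abszN. Qed.

(** Equality holds because the norm is taken on the list of terms: [code_mul] merges no monomials,
    so nothing cancels. *)
Lemma norm1_mul k (p q : poly_code k) :
  norm1 (code_mul p q) = (norm1 p * norm1 q)%N.
Proof.
rewrite /norm1 /code_mul big_allpairs_dep big_distrl; apply: eq_bigr => u _.
by rewrite big_distrr; apply: eq_bigr => v _; rewrite abszM.
Qed.

Lemma boundedM k s1 s2 (p1 p2 : {mpoly rat[k]}) :
  bounded s1 p1 -> bounded s2 p2 -> bounded (s1 + s2) (p1 * p2).
Proof.
case=> [c1 -> le1] [c2 -> le2]; exists (code_mul c1 c2); first by rewrite poly_val_mul.
by rewrite norm1_mul expnD; have := leq_mul le1 le2; nia.
Qed.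

(** The sign covers sums, differences and the comparison of two fractions at once. Each product has
    norm at most a quarter of [2 ^ (s1 + s2)], so together they have at most half of it. *)
Lemma bounded_cross k s1 s2 (b : bool) (p1 q1 p2 q2 : {mpoly rat[k]}) :
  bounded s1 p1 -> bounded s1 q1 -> bounded s2 p2 -> bounded s2 q2 ->
  bounded (s1 + s2) (p1 * q2 + (-1) ^+ b * (p2 * q1)).
Proof.
case=> [c1 -> le1] [d1 -> ld1] [c2 -> le2] [d2 -> ld2].
pose c := code_mul c2 d1.
exists (code_mul c1 d2 ++ if b then code_opp c else c).
  rewrite poly_val_cat poly_val_mul; congr (_ + _).
  by case: b; rewrite ?poly_val_opp poly_val_mul ?expr1 ?mulN1r ?expr0 ?mul1r.
have -> : norm1 (code_mul c1 d2 ++ if b then code_opp c else c) =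
    (norm1 c1 * norm1 d2 + norm1 c2 * norm1 d1)%N.
  by rewrite norm1_cat; case: b; rewrite ?norm1_opp !norm1_mul.
by rewrite expnD; have := leq_mul le1 ld2; have := leq_mul le2 ld1; lia.
Qed.

Definition subst_mpoly k (B : nat) (p : {mpoly rat[k.+1]}) : {mpoly rat[k]} :=
  p \mPo [tuple if unlift ord_max i is Some j then 'X_j
                else (B%:R : rat)%:MP_[k] | i < k.+1].

HB.instance Definition _ k B :=
  GRing.RMorphism.copy (@subst_mpoly k B) (comp_mpoly _).

Lemma bounded_subst_eq0 k s B (p : {mpoly rat[k.+1]}) :
  bounded s p -> (2 ^ s <= B)%N -> (subst_mpoly B p == 0) = (p == 0).
Proof.
case=> c -> le_cs le_sB; apply/idP/idP => [|/eqP->]; last by rewrite rmorph0.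
apply: contraLR => c_neq0; rewrite /subst_mpoly -subst_polyE.
apply: subst_poly_neq0 c_neq0; apply: leq_trans le_sB.
(* A norm of at most half the positive number [2 ^ s] is below it. *)
by have := expn_gt0 2 s; lia.
Qed.

(** * Expression trees over a field of fractions *)

Fixpoint tree_map (C L : Type) (f : C -> L) (T : tree C) : tree L :=
  match T with
  | Leaf a => Leaf (f a)
  | Node o T1 T2 => Node o (tree_map f T1) (tree_map f T2)
  end.

Lemma tree_map_comp (C L K : Type) (f : L -> K) (g : C -> L) T :
  tree_map f (tree_map g T) = tree_map (f \o g) T.
Proof. by elim: T => //= o T1 -> T2 ->. Qed.

Lemma leaves_map (C L : Type) (f : C -> L) T :
  leaves (tree_map f T) = map f (leaves T).
Proof. by elim: T => //= o T1 -> T2 ->; rewrite map_cat. Qed.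

Lemma ops_in_map (C L : Type) (f : C -> L) ops T :
  ops_in ops (tree_map f T) = ops_in ops T.
Proof. by elim: T => //= o T1 -> T2 ->. Qed.

Lemma skeleton_of_map (C L : Type) (f : C -> L) T :
  skeleton_of (tree_map f T) = skeleton_of T.
Proof. by elim: T => //= o T1 -> T2 ->. Qed.

Lemma leaves_lift (C L : Type) (f : C -> L) T s : leaves T = map f s ->
  exists2 T', T = tree_map f T' & leaves T' = s.
Proof.
elim: T s => [a|o T1 IH1 T2 IH2] s /=.
  by case: s => [|c [|d s]] //= [->]; exists (Leaf c).
move=> Es; have /IH1[T1' ET1 leaves1] : leaves T1 = map f (take (size (leaves T1)) s).
  by rewrite map_take -Es take_size_cat.
have /IH2[T2' ET2 leaves2] : leaves T2 = map f (drop (size (leaves T1)) s).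
  by rewrite map_drop -Es drop_size_cat.
exists (Node o T1' T2') => /=; first by rewrite -ET1 -ET2.
by rewrite leaves1 leaves2 cat_take_drop.
Qed.

(** A tree over the values comes from a tree over the codes, which makes sense before and after the
    substitution. Distinct codes may share a value, so a permutation of values is lifted through
    positions. *)
Lemma respects_lift (C : eqType) (F : fieldType) (f : C -> F) v (A : seq C)
    (D : extra v) T :
  respects (map f A) D T ->
  exists T', [/\ T = tree_map f T', perm_eq (leaves T') A
    & forall (K : fieldType) (g : C -> K), respects (map g A) D (tree_map g T')].
Proof.
have perm_lift (s : seq F) : perm_eq s (map f A) -> exists2 s', s = map f s' & perm_eq s' A.
  case: A => [|c A]; first by move/perm_nilP=> ->; exists [::].
  case/(perm_iotaP (f c)) => js perm_js ->; exists (map (nth c (c :: A)) js).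
    rewrite -map_comp; apply/eq_in_map => j; rewrite (perm_mem perm_js) mem_iota.
    by rewrite size_map => lt_j; rewrite /= -(nth_map c (f c) f).
  by rewrite size_map in perm_js; apply/(perm_iotaP c); exists js.
case: v D => /= D.
- case/perm_lift=> s /leaves_lift[T' -> <-] perm_s.
  by exists T'; split=> // K g; rewrite leaves_map perm_map.
- by case/leaves_lift=> T' -> <-; exists T'; split=> // K g; rewrite leaves_map.
case=> <- /perm_lift[s /leaves_lift[T' -> <-] perm_s].
by exists T'; split=> // K g; rewrite leaves_map !skeleton_of_map perm_map.
Qed.

(** * Formal numerators and denominators *)

Section Formal.
Variable R : idomainType.

Definition pair_value (x : R * R) : {fraction R} := tofrac x.1 / tofrac x.2.

(** Fractions are never reduced, so only ring operations occur. The explicit signs match the form of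
    [bounded_cross]. *)
Definition formal_op (o : op) (x y : R * R) : R * R :=
  match o with
  | Add => (x.1 * y.2 + (-1) ^+ false * (y.1 * x.2), x.2 * y.2)
  | Defs.Sub => (x.1 * y.2 + (-1) ^+ true * (y.1 * x.2), x.2 * y.2)
  | Mul => (x.1 * y.1, x.2 * y.2)
  | Div => (x.1 * y.2, x.2 * y.1)
  end.

Fixpoint formal (T : tree (R * R)) : R * R :=
  match T with
  | Leaf x => x
  | Node o T1 T2 => formal_op o (formal T1) (formal T2)
  end.

(** With nonzero denominators at the leaves, a division by zero occurs exactly when some divisor has
    formal numerator zero. *)
Fixpoint regular (T : tree (R * R)) : bool :=
  match T with
  | Leaf _ => true
  | Node o T1 T2 =>
      [&& regular T1, regular T2 & if o is Div then (formal T2).1 != 0 else true]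
  end.

Lemma formal_denom_neq0 T : all (fun x => x.2 != 0) (leaves T) ->
  regular T -> (formal T).2 != 0.
Proof.
elim: T => [x|o T1 IH1 T2 IH2] /=; first by rewrite andbT.
rewrite all_cat => /andP[/IH1{}IH1 /IH2{}IH2] /and3P[/IH1 d1 /IH2 d2].
by case: o => /= n2; rewrite mulf_neq0.
Qed.

Lemma pair_value_eq x y : x.2 != 0 -> y.2 != 0 ->
  (pair_value x == pair_value y) = (x.1 * y.2 + (-1) ^+ true * (y.1 * x.2) == 0).
Proof.
move=> x2 y2; rewrite /pair_value eqr_div ?tofrac_eq0 // -!tofracM tofrac_eq.
by rewrite expr1 mulN1r subr_eq0.
Qed.

Lemma eval_pair_value T : all (fun x => x.2 != 0) (leaves T) ->
  eval (tree_map pair_value T) = if regular T then Some (pair_value (formal T)) else None.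
Proof.
elim: T => [x|o T1 IH1 T2 IH2] //=.
rewrite all_cat => /andP[nz1 nz2]; rewrite IH1 // IH2 //.
case reg1: (regular T1) => //; case reg2: (regular T2) => //=.
have := formal_denom_neq0 nz1 reg1; have := formal_denom_neq0 nz2 reg2.
move: (formal T1) (formal T2) => [n1 d1] [n2 d2]; rewrite /pair_value /= => d2_neq0 d1_neq0.
case: o => /=.
- by rewrite expr0 mul1r tofracD !tofracM addf_div ?tofrac_eq0.
- by rewrite expr1 mulN1r tofracB !tofracM -mulNr addf_div ?tofrac_eq0 // mulNr.
- by rewrite !tofracM mulf_div.
rewrite mulf_eq0 invr_eq0 !tofrac_eq0 (negPf d2_neq0) orbF.
by case: eqP => //= _; rewrite !tofracM invf_div mulf_div.
Qed.

End Formal.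

Definition pair_map (R S : Type) (f : R -> S) (x : R * R) : S * S := (f x.1, f x.2).

(** This is the gain over [eval]: the substitution is a morphism of polynomial rings but does not
    extend to their fraction fields. *)
Lemma formal_map (R S : idomainType) (f : {rmorphism R -> S}) T :
  formal (tree_map (pair_map f) T) = pair_map f (formal T).
Proof.
elim: T => [//|o T1 IH1 T2 IH2] /=; rewrite IH1 IH2.
by case: o; rewrite /pair_map /= ?rmorphD ?rmorphM ?rmorph_sign.
Qed.

(** * Norm bounds for formal evaluation *)

Definition poly_pair k (f : ratfun_code k) : {mpoly rat[k]} * {mpoly rat[k]} :=
  (poly_val f.1, poly_val f.2).

Definition weight k (T : tree (ratfun_code k)) : nat :=
  (\sum_(f <- leaves T) size (enc_ratfun f))%N.

(** Each coefficient is below 2 to the length of its code, and the product of these powers dominates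
    the sum. Discounting the two list brackets leaves room for the factor 2 in [bounded]. *)
Lemma norm1_lt k (p : poly_code k) : (norm1 p < 2 ^ (size (enc_poly p) - 2))%N.
Proof.
have -> : (size (enc_poly p) - 2 = size (flatten (map (@enc_term k) p)))%N.
  by rewrite /enc_poly /enc_seq /bracket /= size_rcons subn2.
rewrite /norm1; elim: p => [|u p IH]; first by rewrite big_nil.
rewrite big_cons.
rewrite -[flatten _]/(enc_term u ++ flatten (map (@enc_term k) p)) size_cat expnD.
have lt_u : (`|u.2| < 2 ^ size (enc_term u))%N.
  apply: (@leq_trans (2 ^ size (bits `|u.2|))).
    by rewrite size_mkseq; apply: up_logP.
  rewrite leq_exp2l // /enc_term /enc_pair /bracket /= size_rcons size_cat enc_intE /=.
  by rewrite size_cat; lia.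
by have := leq_mul lt_u IH; nia.
Qed.

Lemma bounded_poly_pair k (f : ratfun_code k) :
  bounded (size (enc_ratfun f)) (poly_pair f).1 /\
  bounded (size (enc_ratfun f)) (poly_pair f).2.
Proof.
have size_f : size (enc_ratfun f) = (size (enc_poly f.1) + size (enc_poly f.2) + 2)%N.
  by rewrite /enc_ratfun /enc_pair /bracket /= size_rcons size_cat addn2.
have bound p s : (size (enc_poly p) + 1 <= s)%N -> bounded s (poly_val p : {mpoly rat[k]}).
  move=> le_s; exists p => //; have := norm1_lt p.
  have : (2 * 2 ^ (size (enc_poly p) - 2) <= 2 ^ s)%N.
    by rewrite -expnS leq_exp2l //; lia.
  by lia.
by split; apply: bound; lia.
Qed.

Lemma bounded_formal k (T : tree (ratfun_code k)) :
  let x := formal (tree_map (@poly_pair k) T) in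
  bounded (weight T) x.1 /\ bounded (weight T) x.2.
Proof.
elim: T => [f|o T1 [n1 d1] T2 [n2 d2]] /=.
  by rewrite /weight /= big_seq1; apply: bounded_poly_pair.
have -> : weight (Node o T1 T2) = (weight T1 + weight T2)%N by rewrite /weight big_cat.
by case: o; split; do ?[exact: boundedM | exact: bounded_cross].
Qed.

(** * Evaluation before and after the substitution *)

Section Substitution.
Variables (k B : nat).

Definition subst_pair := pair_map (@subst_mpoly k B).

Lemma poly_pair_subst (f : ratfun_code k.+1) :
  poly_pair (subst_ratfun B f) = subst_pair (poly_pair f).
Proof. by rewrite /poly_pair /= !subst_polyE. Qed.

Lemma formal_subst (T : tree (ratfun_code k.+1)) :
  formal (tree_map (@poly_pair k \o @subst_ratfun k B) T) =
  subst_pair (formal (tree_map (@poly_pair k.+1) T)).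
Proof.
rewrite /subst_pair -formal_map tree_map_comp.
by congr formal; elim: T => [f|o T1 IH1 T2 IH2] /=; rewrite ?IH1 ?IH2 ?poly_pair_subst.
Qed.

(** Subtrees weigh no more than the tree, so [B] is large enough for the numerator of every
    divisor. *)
Lemma regular_subst (T : tree (ratfun_code k.+1)) :
  (2 ^ weight T <= B)%N ->
  regular (tree_map (@poly_pair k \o @subst_ratfun k B) T) =
  regular (tree_map (@poly_pair k.+1) T).
Proof.
elim: T => [//|o T1 IH1 T2 IH2] /=; rewrite /weight big_cat expnD => le_B.
have le_B1 : (2 ^ weight T1 <= B)%N.
  by apply: leq_trans le_B; rewrite leq_pmulr ?expn_gt0.
have le_B2 : (2 ^ weight T2 <= B)%N.
  by apply: leq_trans le_B; rewrite leq_pmull ?expn_gt0.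
rewrite IH1 // IH2 // formal_subst.
by case: o => //=; rewrite (bounded_subst_eq0 (proj1 (bounded_formal T2)) le_B2).
Qed.

(** For a regular tree, reaching the target means that a cross-multiplied difference vanishes; its
    norm exponent is the weight of the tree plus the code length of the target. *)
Lemma eval_subst (T : tree (ratfun_code k.+1)) (t : ratfun_code k.+1) :
  (2 ^ (weight T + size (enc_ratfun t)) <= B)%N ->
  all (fun f : ratfun_code k.+1 => poly_val f.2 != 0) (t :: leaves T) ->
  eval (tree_map (@ratfun_val k.+1) T) = Some (ratfun_val t) <->
  eval (tree_map (@ratfun_val k \o @subst_ratfun k B) T) =
    Some (ratfun_val (subst_ratfun B t)).
Proof.
move=> le_B nz_tT.
have weight_f f : f \in t :: leaves T -> (2 ^ size (enc_ratfun f) <= B)%N.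
  move=> f_in; apply: leq_trans le_B; rewrite leq_exp2l //.
  move: f_in; rewrite inE => /predU1P[->|/path.splitPr f_in]; first exact: leq_addl.
  apply: leq_trans (leq_addr _ _); rewrite /weight.
  by case: f_in => s1 s2; rewrite big_cat big_cons /= addnCA leq_addr.
have nz_subst f : f \in t :: leaves T -> poly_val (subst_poly B f.2) != 0.
  move=> f_in; rewrite subst_polyE.
  rewrite (bounded_subst_eq0 (proj2 (bounded_poly_pair f)) (weight_f _ f_in)).
  exact: (allP nz_tT).
have tt : t \in t :: leaves T := mem_head _ _.
have -> : ratfun_val t = pair_value (poly_pair t) by [].
have -> : ratfun_val (subst_ratfun B t) = pair_value (poly_pair (subst_ratfun B t)) by [].
have nz_leaves : all (fun x => x.2 != 0) (leaves (tree_map (@poly_pair k.+1) T)).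
  rewrite leaves_map all_map; apply/allP => f fT.
  by apply: (allP nz_tT); rewrite inE fT orbT.
have nz_leaves' : all (fun x => x.2 != 0)
    (leaves (tree_map (@poly_pair k \o @subst_ratfun k B) T)).
  rewrite leaves_map all_map; apply/allP => f fT.
  by apply: nz_subst; rewrite inE fT orbT.
have -> : tree_map (@ratfun_val k.+1) T =
          tree_map (@pair_value _) (tree_map (@poly_pair k.+1) T) by rewrite tree_map_comp.
have -> : tree_map (@ratfun_val k \o @subst_ratfun k B) T =
          tree_map (@pair_value _) (tree_map (@poly_pair k \o @subst_ratfun k B) T).
  by rewrite tree_map_comp.
have le_BT : (2 ^ weight T <= B)%N.
  by apply: leq_trans le_B; rewrite leq_exp2l // leq_addr.
rewrite !eval_pair_value // regular_subst //; case reg: (regular _) => //.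
have some_eq (F : fieldType) (a b : F) : (Some a = Some b) <-> a == b.
  by split=> [[->]|/eqP->].
rewrite !some_eq pair_value_eq ?formal_denom_neq0 ?(nz_subst _ tt) ?(allP nz_tT _ tt) //.
rewrite pair_value_eq ?formal_denom_neq0 ?regular_subst ?(nz_subst _ tt) //.
rewrite formal_subst poly_pair_subst.
have [n d] := bounded_formal T; have [nt dt] := bounded_poly_pair t.
rewrite -(bounded_subst_eq0 (bounded_cross true n d nt dt) le_B).
by rewrite rmorphD !rmorphM rmorph_sign.
Qed.

End Substitution.

(** * From trees to instances *)

Lemma size_enc_instance k v (I : instance k v) :
  (\sum_(f <- inst_values I) size (enc_ratfun f) + size (enc_ratfun (inst_target I))
    <= size (enc_instance I))%N.
Proof.
rewrite enc_instanceE !size_cat.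
have -> : (\sum_(f <- inst_values I) size (enc_ratfun f) =
           size (flatten (map (@enc_ratfun k) (inst_values I))))%N.
  by rewrite size_flatten /shape -map_comp sumnE big_map.
have -> : size (enc_seq (@enc_ratfun k) (inst_values I)) =
          (size (flatten (map (@enc_ratfun k) (inst_values I)))).+2.
  by rewrite /enc_seq /bracket /= size_rcons.
by lia.
Qed.

Lemma wf_subst k v ops (I : instance k.+1 v) B :
  wf_instance ops I -> (2 ^ size (enc_instance I) <= B)%N ->
  wf_instance ops (subst_instance B I).
Proof.
case/and3P=> nz_vals nz_targ ops_I le_B.
have nz_subst (f : ratfun_code k.+1) :
    (size (enc_ratfun f) <= size (enc_instance I))%N -> poly_val f.2 != 0 ->
    poly_val (subst_poly B f.2) != 0.
  move=> le_f; rewrite subst_polyE.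
  rewrite (bounded_subst_eq0 (proj2 (bounded_poly_pair f))) //.
  by apply: leq_trans le_B; rewrite leq_exp2l.
have := size_enc_instance I => le_I.
apply/and3P; split=> //=.
  rewrite all_map; apply/allP => f f_in; apply: nz_subst (allP nz_vals _ f_in).
  apply: leq_trans le_I; apply: leq_trans (leq_addr _ _).
  by case/path.splitPr: f_in => s1 s2; rewrite big_cat big_cons /= addnCA leq_addr.
by apply: nz_subst nz_targ; apply: leq_trans le_I; apply: leq_addl.
Qed.

Lemma solvable_subst k v ops (I : instance k.+1 v) B :
  wf_instance ops I -> (2 ^ size (enc_instance I) <= B)%N ->
  solvable ops I <-> solvable ops (subst_instance B I).
Proof.
case/and3P=> nz_vals nz_targ _ le_B.
(* Each value is used exactly once, so the weight of the tree and the code length of the target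
   together fit into the length of the encoded instance. *)
have eval_iff T : perm_eq (leaves T) (inst_values I) ->
    eval (tree_map (@ratfun_val k.+1) T) = Some (ratfun_val (inst_target I)) <->
    eval (tree_map (@ratfun_val k \o @subst_ratfun k B) T) =
      Some (ratfun_val (subst_ratfun B (inst_target I))).
  move=> perm_T; apply: eval_subst; last by rewrite /= nz_targ (perm_all _ perm_T).
  apply: leq_trans le_B; rewrite leq_exp2l // /weight (perm_big _ perm_T).
  exact: size_enc_instance.
rewrite /solvable /AEC /= -map_comp.
split=> - [T [ops_T /respects_lift[T' [ET perm_T' resp]] ev_T]].
  exists (tree_map (@ratfun_val k \o @subst_ratfun k B) T').
  by move: ops_T ev_T; rewrite ET !ops_in_map => ops_T /eval_iff evT; split=> //; [exact: resp | exact: evT].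
exists (tree_map (@ratfun_val k.+1) T').
by move: ops_T ev_T; rewrite ET !ops_in_map => ops_T /eval_iff evT; split=> //; [exact: resp | exact: evT].
Qed.

Theorem theorem1 (k : nat) (ops : pred op) (v : variant) :
  exists A : instance k.+1 v -> nat,
    [/\ poly_time (fun I => wf_instance ops I)
          (@enc_instance k.+1 v) enc_nat A,
        forall I : instance k.+1 v, wf_instance ops I -> (0 < A I)%N,
        poly_time
          (fun BI : nat * instance k.+1 v =>
             wf_instance ops BI.2 /\ (A BI.2 <= BI.1)%N)
          (enc_pair enc_nat (@enc_instance k.+1 v)) (@enc_instance k v)
          (fun BI => subst_instance BI.1 BI.2)
      & forall (I : instance k.+1 v) (B : nat),
          wf_instance ops I -> (A I <= B)%N ->
          wf_instance ops (subst_instance B I) /\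
          (solvable ops I <-> solvable ops (subst_instance B I))].
Proof.
exists (fun I => 2 ^ size (enc_instance I))%N; split.
- exact: poly_time_bound.
- by move=> I _; rewrite expn_gt0.
(* The promise makes [B] positive, since it is at least a power of two. *)
- by apply: poly_time_subst => BI [_]; apply: leq_trans; rewrite expn_gt0.
by move=> I B wf_I le_B; split; [apply: wf_subst | apply: solvable_subst].
Qed.
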